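(* Let $q$ be a prime power and let \[ \pi(3,q;(0,1)) = \#\{f \in \mathbb{F}_q[T] \text{ monic of degree } 3 \ : \ f \text{ and } f+1 \text{ are both irreducible in } \mathbb{F}_q[T]\}. \] Then \[ \pi(3,q;(0,1)) = \frac{1}{9} q^3 \cdot \begin{cases} 1 - q^{-1} - 3q^{-2} & \text{if } q \equiv 0 \pmod 3,\\[1ex] 1 + \left(c^2_q - 3\right) q^{-1} -2q^{-2} & \text{if } q \equiv 1 \pmod 3,\\[1ex] 1 - q^{-1} - 2q^{-2} & \text{if } q \equiv 2 \pmod 3, \end{cases} \] where, for $3 \nmid q$, $c_q := \dfrac{1+ q - \#\mathscr{E}(\mathbb{F}_q)}{\sqrt{q}}$, so that $0 \le c_q^2 \le 4$.
   Context: $\mathscr{E}$ denotes the elliptic curve over $\mathbb{Z}[1/3]$ given by the (projective closure of the) Weierstrass equation $X^3 = Y(Y-1)$; for $3 \nmid q$ it has good reduction over $\mathbb{F}_q$, and $\#\mathscr{E}(\mathbb{F}_q)$ is the number of $\mathbb{F}_q$-rational points of the smooth projective reduction (including the point at infinity). *)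

(* Defs.v *)
From mathcomp Require Import all_boot all_order all_algebra.
From mathcomp Require Import boolp reals.

Set Implicit Arguments.
Unset Strict Implicit.
Unset Printing Implicit Defensive.

Import GRing.Theory Num.Theory.
Local Open Scope ring_scope.

(* Every polynomial of degree 3 has size 4, so the finite type {poly_4 F} of
   polynomials of size at most 4 loses nothing. *)
Definition twin_irreducible_cubics (F : finFieldType) : {set {poly_4 F}} :=
  [set p : {poly_4 F} | let f : {poly F} := p in
     [&& f \is monic, size f == 4%N,
         `[< irreducible_poly f >] & `[< irreducible_poly (f + 1) >]]].

Definition pi3_01 (F : finFieldType) : nat := #|twin_irreducible_cubics F|.

(* Homogenization X^3 = Y (Y - Z) Z of X^3 = Y (Y - 1), with v = (X, Y, Z). *)
Definition on_E (F : fieldType) (v : 'rV[F]_3) : bool :=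
  let X := v 0 0 in let Y := v 0 1 in let Z := v 0 2%:R in
  X ^+ 3 == Y * (Y - Z) * Z.

(* The point [X : Y : Z] of the projective plane is the line spanned by
   v = (X, Y, Z) != 0; <<v>>%MS is the canonical matrix of that line, so that
   <<v>>%MS = <<w>>%MS iff v and w are proportional. *)
Definition E_points (F : finFieldType) : {set 'M[F]_3} :=
  [set <<v>>%MS | v : 'rV[F]_3 & (v != 0) && on_E v].

Definition cq (R : realType) (F : finFieldType) : R :=
  (1 + #|F|%:R - #|E_points F|%:R) / Num.sqrt #|F|%:R.

(* Main.v *)
(* Write I(f) for "the monic cubic f has no root in F_q", r(f) for its number of
   roots, n(f) for the number of pairs (x, y) such that (T - x)(T - y) divides f,
   and t(f) for "f is the cube of a linear polynomial". A case check gives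
   n + 3 = 3 r + 3 I + t, so 9 I(f) I(f + 1) is a combination of products of
   r, n, t at f and f + 1. All their sums over f are elementary, except that of
   n(f) n(f + 1), which counts quadruples (u, v, w, d) with u v w = -1 and
   d^2 + e_1 d + e_2 = 0 (e_i symmetric in u, v, w). If cubing is bijective on
   F_q this is (q - 2)^2 by homogeneity, and #E(F_q) = q + 1.

   If q = 1 mod 3, Cardano's resolvent shows that T^3 - 3 m T - n is irreducible
   iff n = z + m^3 / z for a non-cube z. Pairs f, f + 1 with m != 0 are then
   parametrized by z = (c+1)(d+1), z' = c(d+1), m^3 = c(c+1)d(d+1), so the count
   is quadratic in the cyclotomic numbers of order 3. By symmetry there are four
   of them, A, B, C, D, with D = A + 1 and #E(F_q) = 9 D, and the norm q of the
   Jacobi sum determines B C. The same norm gives (q + 1 - 9 D)^2 <= 4 q. *)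
Require Import Defs.
From mathcomp Require Import all_boot all_order all_algebra.
From mathcomp Require Import fingroup cyclic pgroup finfield.
From mathcomp Require Import zify ring.
From mathcomp Require Import boolp reals.

Set Implicit Arguments.
Unset Strict Implicit.
Unset Printing Implicit Defensive.

Import Order.TTheory GRing.Theory Num.Theory.
Local Open Scope ring_scope.

(** * Counting by sums of indicator functions *)

Lemma sum_pred1_nat (T : finType) (P : pred T) (e : T) :
  P =1 pred1 e -> (\sum_x P x = 1)%N.
Proof.
move=> Pe; rewrite (bigD1 e) //= Pe /= eqxx big1 ?addn0 // => x xe.
by rewrite Pe /= (negPf xe).
Qed.

Lemma sum_pred0_nat (T : finType) (P : pred T) :
  P =1 pred0 -> (\sum_x P x = 0)%N.
Proof. by move=> P0; rewrite big1 // => x _; rewrite P0. Qed.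

Lemma sum_pred_card (T : finType) (P : pred T) : (\sum_x P x = #|[pred x | P x]|)%N.
Proof. by rewrite -sum1_card [RHS]big_mkcond. Qed.

Lemma sum_notin (T : finType) (s : seq T) :
  uniq s -> (\sum_(x : T) (x \notin s) = #|T| - size s)%N.
Proof.
by move=> /card_uniqP <-; rewrite -(cardC [in s]) addKn sum_pred_card; apply: eq_card.
Qed.

Lemma sum_predC1 (T : finType) (e : T) : (\sum_x (x != e) = #|T|.-1)%N.
Proof.
rewrite -subn1 -(@sum_notin _ [:: e]) //.
by apply: eq_bigr => x _; rewrite inE.
Qed.

Lemma sum_pred1_mul (T : finType) (P : pred T) (e : T) (G : T -> nat) :
  P =1 pred1 e -> (\sum_x P x * G x = G e)%N.
Proof.
move=> Pe; rewrite (bigD1 e) //= Pe /= eqxx mul1n big1 ?addn0 // => x xe.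
by rewrite Pe /= (negPf xe).
Qed.

(** * Root statistics of monic cubics *)

Section Cubics.
Variable F : finFieldType.
Implicit Types a b c e s t u v w x y z d : F.
Local Notation q := #|F|.

Definition cubic a b c x : F := x ^+ 3 + a * x ^+ 2 + b * x + c.
(* The divided difference of [cubic a b c]. *)
Definition cubic_dd a b x y : F := x ^+ 2 + x * y + y ^+ 2 + a * (x + y) + b.
Definition nroots a b c : nat := (\sum_x (cubic a b c x == 0)%R)%N.
Definition nsplits a b c : nat :=
  (\sum_x \sum_y ((cubic a b c x == 0) && (cubic_dd a b x y == 0))%R)%N.
Definition ncubes a b c : nat :=
  (\sum_x [&& a == - (3 * x), b == 3 * x ^+ 2 & c == - x ^+ 3]%R)%N.
Definition rootless a b c : bool := [forall x, cubic a b c x != 0].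

Lemma cubicB a b c x y :
  cubic a b c y - cubic a b c x = (y - x) * cubic_dd a b x y.
Proof. by rewrite /cubic /cubic_dd; ring. Qed.

Lemma cubic_split x y z t :
  cubic (- (x + y + z)) (x * y + y * z + z * x) (- (x * y * z)) t =
  (t - x) * (t - y) * (t - z).
Proof. by rewrite /cubic; ring. Qed.

Lemma sum_roots2 y z : y != z -> (\sum_s ((s - y) * (s - z) == 0)%R = 2)%N.
Proof.
move=> yz; rewrite (bigD1 y) //= (bigD1 z) 1?eq_sym //= !subrr mul0r mulr0 eqxx.
rewrite big1 // => s /andP[sy sz].
by rewrite mulf_eq0 !subr_eq0 (negPf sy) (negPf sz).
Qed.

Lemma sum_roots1 y : (\sum_s ((s - y) * (s - y) == 0)%R = 1)%N.
Proof. by apply: (@sum_pred1_nat _ _ y) => s; rewrite mulf_eq0 orbb subr_eq0. Qed.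

Lemma cubic_count_rootless a b c : rootless a b c ->
  (nsplits a b c + 3 = 3 * nroots a b c + 3 * rootless a b c + ncubes a b c)%N.
Proof.
move=> nr; rewrite nr; move/forallP: nr => nr.
rewrite /nsplits /nroots /ncubes !big1 // => [x _|x _|x _].
- apply/eqP; rewrite eqb0; apply: contra (nr x).
  by case/and3P=> /eqP-> /eqP-> /eqP->; apply/eqP; rewrite /cubic; ring.
- by rewrite (negPf (nr x)).
- by rewrite big1 // => y _; rewrite (negPf (nr x)).
Qed.

Lemma nsplits_sum a b c :
  nsplits a b c =
  (\sum_(x | cubic a b c x == 0%R) \sum_y (cubic_dd a b x y == 0)%R)%N.
Proof.
rewrite /nsplits [RHS]big_mkcond; apply: eq_bigr => x _.
by case: eqP => _ //=; rewrite big1.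
Qed.

Lemma nroots_sum a b c : nroots a b c = (\sum_(x | cubic a b c x == 0%R) 1)%N.
Proof. by rewrite /nroots [RHS]big_mkcond; apply: eq_bigr => x _; case: eqP. Qed.

(** The cofactor of T - x has no root, so x is the only root and no product of two linear factors
    divides f: r = 1 and n = t = 0. A cube (T - x)^3 is excluded because its cofactor vanishes at
    x. *)
Lemma cubic_count_one_root a b c x : cubic a b c x = 0 ->
    (forall y, cubic_dd a b x y != 0) ->
  (nsplits a b c + 3 = 3 * nroots a b c + 3 * rootless a b c + ncubes a b c)%N.
Proof.
move=> x0 nd.
have -> : rootless a b c = false.
  by apply/negbTE; rewrite negb_forall; apply/existsP; exists x; rewrite x0 eqxx.
have rx t : (cubic a b c t == 0) = (t == x).
  apply/eqP/eqP => [t0|->//]; apply/eqP; rewrite -subr_eq0.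
  have /eqP := cubicB a b c x t; rewrite t0 x0 subrr eq_sym mulf_eq0.
  by rewrite (negPf (nd t)) orbF.
rewrite nsplits_sum nroots_sum !(eq_bigl _ _ rx) !big_pred1_eq big1 => [|y _]; last first.
  by rewrite (negPf (nd y)).
rewrite /ncubes sum_pred0_nat // => t /=; apply/negP=> /and3P[/eqP a0 /eqP b0 /eqP c0].
have /eqP tx : t == x by rewrite -rx; apply/eqP; rewrite /cubic a0 b0 c0; ring.
by case/negP: (nd x); apply/eqP; rewrite /cubic_dd a0 b0 tx; ring.
Qed.

(** If (T - x)(T - y)(T - z) = (T - t)^3, evaluation at x, y and z shows that all three equal t. *)
Lemma ncubes_split x y z : ~~ ((x == y) && (y == z)) ->
  ncubes (- (x + y + z)) (x * y + y * z + z * x) (- (x * y * z)) = 0%N.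
Proof.
move=> xyz; rewrite /ncubes sum_pred0_nat // => t /=.
apply: contraNF xyz => /and3P[/eqP a0 /eqP b0 /eqP c0].
have cub s : (s - x) * (s - y) * (s - z) = (s - t) ^+ 3.
  by rewrite -cubic_split a0 b0 c0 /cubic; ring.
have E s : (s - x) * (s - y) * (s - z) = 0 -> s = t.
  by rewrite cub => /eqP; rewrite expf_eq0 subr_eq0 => /andP[_ /eqP].
have xt : x = t by apply: E; rewrite subrr !mul0r.
have yt : y = t by apply: E; rewrite subrr mulr0 mul0r.
have zt : z = t by apply: E; rewrite subrr mulr0.
by rewrite xt yt zt eqxx.
Qed.

(** The divided difference at one root is the product over the other two roots. Hence (r, n, t) is
    (1, 1, 1) for a triple root, (2, 3, 0) for a double root and a simple one, and (3, 6, 0) for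
    three distinct roots. *)
Lemma cubic_count_split x y z
  (a := - (x + y + z)) (b := x * y + y * z + z * x) (c := - (x * y * z)) :
  (nsplits a b c + 3 = 3 * nroots a b c + 3 * rootless a b c + ncubes a b c)%N.
Proof.
have -> : rootless a b c = false.
  apply/negbTE; rewrite negb_forall; apply/existsP; exists x.
  by rewrite cubic_split subrr !mul0r eqxx.
have rE t : (cubic a b c t == 0) = [|| t == x, t == y | t == z].
  by rewrite cubic_split !mulf_eq0 !subr_eq0 orbA.
rewrite nsplits_sum nroots_sum !(eq_bigl _ _ rE).
have dx : (fun s => nat_of_bool (cubic_dd a b x s == 0)) =1
  fun s => nat_of_bool ((s - y) * (s - z) == 0).
  by move=> s; congr (nat_of_bool (_ == 0)); rewrite /cubic_dd /a /b; ring.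
have dy : (fun s => nat_of_bool (cubic_dd a b y s == 0)) =1
  fun s => nat_of_bool ((s - x) * (s - z) == 0).
  by move=> s; congr (nat_of_bool (_ == 0)); rewrite /cubic_dd /a /b; ring.
have dz : (fun s => nat_of_bool (cubic_dd a b z s == 0)) =1
  fun s => nat_of_bool ((s - x) * (s - y) == 0).
  by move=> s; congr (nat_of_bool (_ == 0)); rewrite /cubic_dd /a /b; ring.
have two (y' z' : F) (G : F -> nat) : y' != z' ->
    (\sum_(t | (t == y') || (t == z')) G t = G y' + G z')%N.
  move=> ne; rewrite (bigD1 y') ?eqxx //= (big_pred1 z') // => t /=.
  by case: (eqVneq t y') => [->|]; rewrite ?(negPf ne) ?andbT ?andbF.
case: (eqVneq x y) => [xy|xy].
  case: (eqVneq y z) => [yz|yz].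
    have pE t : [|| t == x, t == y | t == z] = (t == x) by rewrite -yz -xy !orbb.
    rewrite !(eq_bigl _ _ pE) !big_pred1_eq.
    rewrite (eq_bigr _ (fun s _ => dx s)) -yz sum_roots1 /ncubes /a /b /c -yz -xy.
    rewrite (@sum_pred1_nat _ _ x) // => t /=.
    apply/idP/eqP => [/and3P[/eqP h1 /eqP h2 /eqP h3]|->].
      have: cubic (- (x + x + x)) (x * x + x * x + x * x) (- (x * x * x)) t = (t - t) ^+ 3.
        by rewrite h1 h2 h3 /cubic; ring.
      rewrite cubic_split subrr expr0n /= => /eqP.
      by rewrite !mulf_eq0 !orbb subr_eq0 => /eqP.
    by apply/and3P; split; apply/eqP; ring.
  have pE t : [|| t == x, t == y | t == z] = (t == y) || (t == z).
    by rewrite xy orbA orbb.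
  rewrite !(eq_bigl _ _ pE) !two // (eq_bigr _ (fun s _ => dy s)).
  rewrite [X in (_ + X + _)%N](eq_bigr _ (fun s _ => dz s)).
  by rewrite xy sum_roots2 // sum_roots1 ncubes_split ?(negPf yz) ?andbF.
case: (eqVneq y z) => [yz|yz].
  have pE t : [|| t == x, t == y | t == z] = (t == x) || (t == y).
    by rewrite -yz orbb.
  rewrite !(eq_bigl _ _ pE) !two // (eq_bigr _ (fun s _ => dx s)).
  rewrite [X in (_ + X + _)%N](eq_bigr _ (fun s _ => dy s)).
  by rewrite -yz sum_roots1 sum_roots2 // ncubes_split ?(negPf xy).
case: (eqVneq x z) => [xz|xz].
  have pE t : [|| t == x, t == y | t == z] = (t == x) || (t == y).
    by rewrite -xz; case: (t == x); rewrite ?orbF ?orbT.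
  rewrite !(eq_bigl _ _ pE) !two // (eq_bigr _ (fun s _ => dx s)).
  rewrite [X in (_ + X + _)%N](eq_bigr _ (fun s _ => dy s)).
  by rewrite -xz sum_roots2 1?eq_sym // sum_roots1 ncubes_split ?(negPf xy).
have three (G : F -> nat) :
    (\sum_(t | [|| t == x, t == y | t == z]) G t = G x + (G y + G z))%N.
  rewrite (bigD1 x) ?eqxx //= -two //; congr addn; apply: eq_bigl => t.
  by case: (eqVneq t x) => [->|]; rewrite ?(negPf xy) ?(negPf xz) ?andbT ?andbF.
rewrite !three (eq_bigr _ (fun s _ => dx s)).
rewrite [X in (_ + (X + _) + _)%N](eq_bigr _ (fun s _ => dy s)).
rewrite [X in (_ + (_ + X) + _)%N](eq_bigr _ (fun s _ => dz s)).
by rewrite !sum_roots2 // ncubes_split ?(negPf xy).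
Qed.

Lemma cubic_count a b c :
  (nsplits a b c + 3 = 3 * nroots a b c + 3 * rootless a b c + ncubes a b c)%N.
Proof.
case: (boolP (rootless a b c)) => [nr|].
  by have := cubic_count_rootless nr; rewrite nr.
rewrite negb_forall => /existsP[x /negbNE/eqP x0].
case: (boolP [forall y, cubic_dd a b x y != 0]) => [/forallP nd|].
  have := cubic_count_one_root x0 nd.
  suff -> : rootless a b c = false by [].
  by apply/negbTE; rewrite negb_forall; apply/existsP; exists x; rewrite x0 eqxx.
rewrite negb_forall => /existsP[y /negbNE/eqP d0].
(* Two linear factors split off, so the third root is -a - x - y by Vieta. *)
have := cubic_count_split x y (- a - x - y); cbv zeta.
have -> : - (x + y + (- a - x - y)) = a by ring.
have bE : b = - (x ^+ 2 + x * y + y ^+ 2 + a * (x + y)).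
  by apply/eqP; rewrite -subr_eq0 opprK -d0 /cubic_dd; apply/eqP; ring.
have -> : x * y + y * (- a - x - y) + (- a - x - y) * x = b by rewrite bE; ring.
have -> : - (x * y * (- a - x - y)) = c.
  apply/eqP; rewrite -subr_eq0 -oppr_eq0; apply/eqP; rewrite -x0 /cubic bE; ring.
suff -> : rootless a b c = false by [].
by apply/negbTE; rewrite negb_forall; apply/existsP; exists x; rewrite x0 eqxx.
Qed.

(** * Sums of products of root statistics over all monic cubics *)

Definition sum3 (phi : F -> F -> F -> nat) : nat :=
  (\sum_a \sum_b \sum_c phi a b c)%N.

Lemma eq_sum3 (phi psi : F -> F -> F -> nat) :
  (forall a b c, phi a b c = psi a b c) -> sum3 phi = sum3 psi.
Proof. by move=> E; do 3!(apply: eq_bigr => ? _). Qed.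

Lemma sum3D (phi psi : F -> F -> F -> nat) :
  sum3 (fun a b c => phi a b c + psi a b c)%N = (sum3 phi + sum3 psi)%N.
Proof. by rewrite /sum3 -big_split; do 2!(apply: eq_bigr => ? _; rewrite -big_split). Qed.

Lemma sum3Z n (phi : F -> F -> F -> nat) :
  sum3 (fun a b c => n * phi a b c)%N = (n * sum3 phi)%N.
Proof. by rewrite /sum3 big_distrr; do 2!(apply: eq_bigr => ? _; rewrite big_distrr). Qed.

Lemma sum3_const n : sum3 (fun _ _ _ => n) = (q ^ 3 * n)%N.
Proof. by rewrite /sum3 !sum_nat_const !expnS expn0 muln1 !mulnA. Qed.

Lemma sum3_exchange (I : finType) (G : I -> F -> F -> F -> nat) :
  sum3 (fun a b c => \sum_i G i a b c)%N = (\sum_i sum3 (G i))%N.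
Proof.
rewrite /sum3 [RHS]exchange_big; apply: eq_bigr => a _.
rewrite [RHS]exchange_big; apply: eq_bigr => b _.
by rewrite [RHS]exchange_big.
Qed.

Lemma sum3_shift e (phi : F -> F -> F -> nat) :
  sum3 (fun a b c => phi a b (c + e)) = sum3 phi.
Proof.
do 2!(apply: eq_bigr => ? _).
by rewrite [RHS](reindex_inj (addIr e)).
Qed.

(** A root x together with a and b determines c, so a sum weighted by r runs over free x, a, b. *)
Lemma sum3_nroots (phi : F -> F -> F -> nat) :
  sum3 (fun a b c => nroots a b c * phi a b c)%N =
  (\sum_x \sum_a \sum_b phi a b (- (x ^+ 3 + a * x ^+ 2 + b * x))%R)%N.
Proof.
under eq_sum3 => a b c do rewrite /nroots big_distrl /=.
rewrite sum3_exchange; apply: eq_bigr => x _.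
apply: eq_bigr => a _; apply: eq_bigr => b _.
by apply: sum_pred1_mul => c /=; rewrite /cubic addrC addr_eq0.
Qed.

(** Given the factors T - x and T - y, the choice of a amounts to that of the third root z, and then
    b and c are determined. The weighted sum thus runs over all triples of roots. *)
Lemma sum3_nsplits (phi : F -> F -> F -> nat) :
  sum3 (fun a b c => nsplits a b c * phi a b c)%N =
  (\sum_x \sum_y \sum_z
     phi (- (x + y + z))%R (x * y + y * z + z * x)%R (- (x * y * z))%R)%N.
Proof.
under eq_sum3 => a b c do rewrite /nsplits big_distrl /=.
rewrite sum3_exchange; apply: eq_bigr => x _.
under eq_sum3 => a b c do rewrite big_distrl /=.
rewrite sum3_exchange; apply: eq_bigr => y _.
have inj : injective (fun z => - (x + y + z)).
  by move=> z z' /oppr_inj/addrI.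
rewrite /sum3 (reindex_inj inj); apply: eq_bigr => z _ /=.
under eq_bigr => b _ do under eq_bigr => c _ do rewrite -mulnb mulnAC mulnC.
under eq_bigr => b _ do rewrite -big_distrr /=.
rewrite (@sum_pred1_mul _ _ (x * y + y * z + z * x)) => [|b /=]; last first.
  by rewrite -[RHS]subr_eq0; congr (_ == 0); rewrite /cubic_dd; ring.
rewrite (@sum_pred1_mul _ _ (- (x * y * z))) // => c /=.
by rewrite -[RHS]subr_eq0; congr (_ == 0); rewrite /cubic; ring.
Qed.

Lemma sum3_ncubes (phi : F -> F -> F -> nat) :
  sum3 (fun a b c => ncubes a b c * phi a b c)%N =
  (\sum_x phi (- (3 * x))%R (3 * x ^+ 2)%R (- x ^+ 3)%R)%N.
Proof.
under eq_sum3 => a b c do rewrite /ncubes big_distrl /=.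
rewrite sum3_exchange; apply: eq_bigr => x _; rewrite /sum3.
under eq_bigr => a _ do under eq_bigr => b _ do
  under eq_bigr => c _ do rewrite -!mulnb -!mulnA.
under eq_bigr => a _ do under eq_bigr => b _ do rewrite -2!big_distrr /=.
under eq_bigr => a _ do rewrite -big_distrr /=.
rewrite (@sum_pred1_mul _ _ (- (3 * x))) //.
rewrite (@sum_pred1_mul _ _ (3 * x ^+ 2)) //.
by rewrite (@sum_pred1_mul _ _ (- x ^+ 3)).
Qed.

Lemma sum3_nroots1 : sum3 (@nroots) = (q ^ 3)%N.
Proof.
rewrite -[LHS](eq_sum3 (fun a b c => muln1 (nroots a b c))) sum3_nroots.
by rewrite !sum_nat_const !expnS expn0.
Qed.

Lemma sum3_nsplits1 : sum3 (@nsplits) = (q ^ 3)%N.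
Proof.
rewrite -[LHS](eq_sum3 (fun a b c => muln1 (nsplits a b c))) sum3_nsplits.
by rewrite !sum_nat_const !expnS expn0.
Qed.

Lemma sum3_ncubes1 : sum3 (@ncubes) = q.
Proof.
rewrite -[LHS](eq_sum3 (fun a b c => muln1 (ncubes a b c))) sum3_ncubes.
by rewrite sum_nat_const muln1.
Qed.

Lemma card_rootless :
  (3 * sum3 (fun a b c => rootless a b c) + q = q ^ 3)%N.
Proof.
(* The variable [k] stands for 3, so that products by it cannot compute while [sum3D] and [sum3Z]
   are rewritten. *)
have [k k3] : {k | k = 3%N} by exists 3%N.
have := eq_sum3 cubic_count; rewrite -k3 !sum3D !sum3Z sum3_const.
by rewrite k3 sum3_nroots1 sum3_nsplits1 sum3_ncubes1; lia.
Qed.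

(** Let x be a root of f and y one of f + e. Then x != y since e != 0, and for given x, y and a the
    difference of the two equations is linear in b with leading coefficient y - x. *)
Lemma sum3_nroots_nroots e : e != 0 ->
  sum3 (fun a b c => nroots a b c * nroots a b (c + e)%R)%N = (q ^ 2 * q.-1)%N.
Proof.
move=> e0; rewrite (sum3_nroots (fun a b c => nroots a b (c + e))).
transitivity (\sum_(x : F) \sum_(a : F) \sum_(y : F) (y != x))%N; last first.
  under eq_bigr => x _ do under eq_bigr => a _ do rewrite sum_predC1.
  by rewrite !sum_nat_const !expnS expn0 muln1 !mulnA.
apply: eq_bigr => x _; apply: eq_bigr => a _; rewrite exchange_big.
apply: eq_bigr => y _; have [->|yx] := eqVneq y x.
  rewrite sum_pred0_nat // => b /=; apply/negbTE.
  by apply: contra e0 => /eqP <-; apply/eqP; rewrite /cubic; ring.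
have yx0 : y - x != 0 by rewrite subr_eq0.
rewrite (@sum_pred1_nat _ _
  (- (x ^+ 2 + x * y + y ^+ 2 + a * (x + y)) - e / (y - x))) // => b /=.
rewrite -[RHS]subr_eq0 -[RHS](mulrI_eq0 _ (lregP yx0)); congr (_ == 0).
by rewrite /cubic; field.
Qed.

(** If f has the roots x, y, z and t is a root of f + e, then (t - x)(t - y)(t - z) = -e. So t is
    free, x and y are any elements other than t, and z is determined. *)
Lemma sum3_nsplits_nroots e : e != 0 ->
  sum3 (fun a b c => nsplits a b c * nroots a b (c + e)%R)%N =
  (q * (q.-1 * q.-1))%N.
Proof.
move=> e0; rewrite (sum3_nsplits (fun a b c => nroots a b (c + e))).
rewrite /nroots.
transitivity (\sum_(t : F) \sum_(x : F) \sum_(y : F) (x != t) * (y != t))%N; last first.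
  under eq_bigr => t _ do under eq_bigr => x _ do rewrite -big_distrr /= sum_predC1.
  under eq_bigr => t _ do rewrite -big_distrl /= sum_predC1.
  by rewrite sum_nat_const.
rewrite [RHS]exchange_big; apply: eq_bigr => x _.
rewrite [RHS]exchange_big; apply: eq_bigr => y _.
rewrite [LHS]exchange_big; apply: eq_bigr => t _ /=.
have cE z : cubic (- (x + y + z)) (x * y + y * z + z * x) (- (x * y * z) + e) t
          = (t - x) * (t - y) * (t - z) + e by rewrite /cubic; ring.
under eq_bigr => z _ do rewrite cE.
have [->|xt] := eqVneq x t.
  by rewrite sum_pred0_nat // => z /=; rewrite subrr !mul0r add0r (negPf e0).
have [->|yt] := eqVneq y t.
  by rewrite sum_pred0_nat // => z /=; rewrite subrr mulr0 mul0r add0r (negPf e0).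
have k0 : (t - x) * (t - y) != 0 by rewrite mulf_neq0 // subr_eq0 eq_sym.
have k1 : t - x != 0 by rewrite subr_eq0 eq_sym.
have k2 : t - y != 0 by rewrite subr_eq0 eq_sym.
rewrite (@sum_pred1_nat _ _ (t + e / ((t - x) * (t - y)))) // => z /=.
rewrite -[RHS]subr_eq0 -[RHS](mulrI_eq0 _ (lregP k0)) -[RHS]oppr_eq0; congr (_ == 0).
by field; rewrite ?k1 ?k2.
Qed.

Lemma sum3_nroots_nsplits e : e != 0 ->
  sum3 (fun a b c => nroots a b c * nsplits a b (c + e)%R)%N =
  (q * (q.-1 * q.-1))%N.
Proof.
move=> e0; rewrite -(sum3_nsplits_nroots (e := - e)) ?oppr_eq0 //.
rewrite -(sum3_shift e (fun a b c => nsplits a b c * nroots a b (c - e)%R)%N).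
by apply: eq_sum3 => a b c; rewrite addrK mulnC.
Qed.

(** Let s and s + d be the two chosen roots of f + 1, and s - u, s - v, s - w the roots of f. The
    conditions in u, v, w, d do not involve s, which accounts for the factor q. *)
Lemma sum3_nsplits_nsplits :
  sum3 (fun a b c => nsplits a b c * nsplits a b (c + 1)%R)%N =
  (q * \sum_(u : F) \sum_(v : F) \sum_(w : F) \sum_d
     ((u * v * w + 1 == 0) &&
      (d ^+ 2 + (u + v + w) * d + (u * v + v * w + w * u) == 0))%R)%N.
Proof.
rewrite (sum3_nsplits (fun a b c => nsplits a b (c + 1))) /nsplits.
rewrite -sum_nat_const.
under [LHS]eq_bigr => x _ do under eq_bigr => y _ do rewrite exchange_big /=.
under [LHS]eq_bigr => x _ do rewrite exchange_big /=.
rewrite [LHS]exchange_big /=; apply: eq_bigr => s _.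
have inj : injective (fun u => s - u) by move=> u u' /addrI/oppr_inj.
rewrite (reindex_inj inj); apply: eq_bigr => u _ /=.
rewrite (reindex_inj inj); apply: eq_bigr => v _ /=.
rewrite (reindex_inj inj); apply: eq_bigr => w _ /=.
rewrite (reindex_inj (addrI s)); apply: eq_bigr => d _ /=.
by congr nat_of_bool; congr (_ && _); congr (_ == 0); rewrite /cubic /cubic_dd; ring.
Qed.

(* The equations are homogeneous, so bijectivity of cubing lets one scale
   [w] to 1; what remains is linear in [v]. *)
Lemma count_quadric : injective (fun x : F => x ^+ 3) ->
  (\sum_(u : F) \sum_(v : F) \sum_(w : F) \sum_d
     ((u * v * w + 1 == 0) &&
      (d ^+ 2 + (u + v + w) * d + (u * v + v * w + w * u) == 0))%R =
   (q - 2) * (q - 2))%N.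
Proof.
move=> injc.
transitivity (\sum_(u : F) \sum_(v : F) \sum_d
  [&& u != 0, v != 0 & d ^+ 2 + (u + v + 1) * d + (u * v + v + u) == 0]%R)%N.
  transitivity (\sum_(w : F) \sum_(u : F) \sum_(v : F) \sum_(d : F) 
     ((u * v * w ^+ 3 + 1 == 0) && (w != 0))%R *
      (d ^+ 2 + (u + v + 1) * d + (u * v + v + u) == 0)%R)%N.
    under eq_bigr => u _ do rewrite exchange_big /=.
    rewrite exchange_big; apply: eq_bigr => w _ /=.
    have [->|w0] := eqVneq w 0.
      by rewrite !big1 // => ? _; rewrite !big1 // => ? _; rewrite !big1 // => ? _;
        rewrite ?andbF // mulr0 add0r oner_eq0.
    rewrite (reindex_inj (mulfI w0)); apply: eq_bigr => u _ /=.
    rewrite (reindex_inj (mulfI w0)); apply: eq_bigr => v _ /=.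
    rewrite (reindex_inj (mulfI w0)); apply: eq_bigr => d _ /=.
    rewrite andbT mulnb; congr nat_of_bool; congr (_ && _).
      by congr (_ == 0); ring.
    rewrite -[RHS](mulrI_eq0 _ (lregP (expf_neq0 2 w0))); congr (_ == 0); ring.
  rewrite exchange_big; apply: eq_bigr => u _ /=.
  rewrite exchange_big; apply: eq_bigr => v _ /=.
  rewrite exchange_big; apply: eq_bigr => d _ /=.
  rewrite -big_distrl /= andbA -mulnb; congr muln.
  have [->|u0] := eqVneq u 0.
    by rewrite sum_pred0_nat // => w /=; rewrite !mul0r add0r oner_eq0.
  have [->|v0] := eqVneq v 0.
    by rewrite sum_pred0_nat // => w /=; rewrite mulr0 mul0r add0r oner_eq0.
  have uv0 : u * v != 0 by rewrite mulf_neq0.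
  have [cbrt cbrtK Kcbrt] := injF_bij injc.
  rewrite (@sum_pred1_nat _ _ (cbrt (- (u * v)^-1))) // => w /=.
  rewrite -[RHS](inj_eq injc) Kcbrt -[RHS](inj_eq (mulfI uv0)) mulrN divff // addr_eq0.
  apply/andP/idP => [[]//|E]; split=> //; apply: contraTneq E => ->.
  by rewrite expr0n mulr0 eq_sym oppr_eq0 oner_eq0.
(* The equation in v is v (d + u + 1) + (d + 1)(d + u) = 0. For d = -u - 1 it reads u = 0 and has no
   solution; for d = -1 or d = -u its only solution is the forbidden v = 0; any other d gives
   exactly one nonzero v. *)
transitivity (\sum_(u : F) (u != 0%R) * \sum_(d : F) (d \notin [:: - u - 1; -1; - u]%R))%N.
  apply: eq_bigr => u _; rewrite exchange_big big_distrr; apply: eq_bigr => d _ /=.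
  have [->|u0] := eqVneq u 0; first by rewrite sum_pred0_nat.
  have E v : d ^+ 2 + (u + v + 1) * d + (u * v + v + u) =
             v * (d - (- u - 1)) + (d - -1) * (d - - u) by ring.
  under eq_bigr => v _ do rewrite E /=.
  rewrite mul1n !inE !negb_or; have [d1|d1] := eqVneq d (- u - 1).
    rewrite sum_pred0_nat // => v /=; apply/negbTE; rewrite negb_and.
    apply/orP; right; apply: contra u0 => /eqP <-; rewrite d1; apply/eqP; ring.
  have d1' : d - (- u - 1) != 0 by rewrite subr_eq0.
  have [->|d2] := eqVneq d (- 1).
    rewrite sum_pred0_nat // => v /=.
    rewrite subrr mul0r addr0 mulf_eq0.
    have -> : -1 - (- u - 1) = u by ring.
    by rewrite (negPf u0) orbF andNb.
  have [->|d3] := eqVneq d (- u).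
    rewrite sum_pred0_nat // => v /=.
    rewrite subrr mulr0 addr0 mulf_eq0.
    have -> : - u - (- u - 1) = 1 by ring.
    by rewrite oner_eq0 orbF andNb.
  rewrite (@sum_pred1_nat _ _ (- ((d - -1) * (d - - u)) / (d - (- u - 1)))) // => v /=.
  rewrite addr_eq0 (can2_eq (mulfK d1') (mulfVK d1')).
  apply/andP/idP => [[]//|/eqP E']; split; last by apply/eqP.
  apply/eqP => v0; move/eqP: E'; rewrite v0.
  by rewrite eq_sym mulf_eq0 oppr_eq0 mulf_eq0 invr_eq0 !subr_eq0 (negPf d1) (negPf d2) (negPf d3).
(* At u = 1 two of the three excluded values of d coincide, which leaves q - 2 of them. Each of the
   q - 2 remaining nonzero u leaves q - 3, and the total is (q - 2)^2. *)
rewrite (bigD1 0) //= eqxx mul0n add0n (bigD1 1) ?oner_neq0 //= mul1n.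
have -> : (\sum_(d : F) (d \notin [:: - 1 - 1; -1; -1]%R) = q - 2)%N.
  rewrite -(@sum_notin _ [:: - 1 - 1; - 1]%R) /=.
    by apply: eq_bigr => d _; rewrite !inE orbb.
  by rewrite inE andbT -subr_eq0 opprK subrK oppr_eq0 oner_eq0.
rewrite (eq_bigr (fun=> q - 3))%N => [|u /andP[u0 u1]]; last first.
  rewrite u0 mul1n sum_notin //= !inE negb_or !andbT.
  rewrite -subr_eq0 opprK subrK oppr_eq0 u0 /=.
  rewrite -subr_eq0 addrAC subrr add0r oppr_eq0 oner_eq0 /=.
  by rewrite eqr_opp eq_sym.
rewrite sum_nat_const.
have -> : #|[pred u : F | (u != 0) && (u != 1)]| = (q - 2)%N.
  rewrite -(@sum_notin _ [:: 0; 1 : F]); last by rewrite /= inE eq_sym oner_eq0.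
  by rewrite -sum_pred_card; apply: eq_bigr => u _; rewrite /= !inE negb_or.
have -> : (q - 3 = (q - 2).-1)%N by lia.
by case: (q - 2)%N => // k; rewrite -mulnS.
Qed.

(** The cubic (T - x)^3 + 1 has the root x - 1. *)
Lemma ncubes_rootless_succ a b c : (ncubes a b c * rootless a b (c + 1)%R = 0)%N.
Proof.
case: (boolP (rootless _ _ _)) => [/forallP nr|_]; last by rewrite muln0.
rewrite /ncubes sum_pred0_nat // => x /=; apply/negP=> /and3P[/eqP a0 /eqP b0 /eqP c0].
by case/negP: (nr (x - 1)); apply/eqP; rewrite /cubic a0 b0 c0; ring.
Qed.

(** The cubic (T - x)^3 - 1 has the root x + 1. *)
Lemma rootless_ncubes_succ a b c : (rootless a b c * ncubes a b (c + 1)%R = 0)%N.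
Proof.
case: (boolP (rootless _ _ _)) => [/forallP nr|_]; last by rewrite mul0n.
rewrite /ncubes sum_pred0_nat // => x /=; apply/negP=> /and3P[/eqP a0 /eqP b0 /eqP c0].
have {}c0 : c = - x ^+ 3 - 1 by rewrite -c0 addrK.
by case/negP: (nr (x + 1)); apply/eqP; rewrite /cubic a0 b0 c0; ring.
Qed.

(** Multiply n + 3 - 3 r = 3 i + t by its primed counterpart: the mixed terms t i' and i t' vanish.
    The negative terms are moved across to stay within natural numbers. *)
Lemma moment_identity (n r i t n' r' i' t' : nat) :
    (n + 3 = 3 * r + 3 * i + t -> n' + 3 = 3 * r' + 3 * i' + t' ->
     t * i' = 0 -> i * t' = 0 ->
  9 * (i * i') + t * t' + 3 * (n * r') + 3 * (r * n') + 9 * r + 9 * r' =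
  n * n' + 9 * (r * r') + 3 * n + 3 * n' + 9)%N.
Proof.
move=> h h' e e'; apply/eqP; rewrite -(eqr_nat int); apply/eqP.
have {}h : n%:R = 3 * r%:R + 3 * i%:R + t%:R - 3 :> int by lia.
have {}h' : n'%:R = 3 * r'%:R + 3 * i'%:R + t'%:R - 3 :> int by lia.
have {}e : t%:R * i'%:R = 0 :> int by rewrite -natrM e.
have {}e' : i%:R * t'%:R = 0 :> int by rewrite -natrM e'.
rewrite !(natrD, natrM) h h'.
set lhs := LHS; set rhs := RHS.
have : lhs + 3 * (t%:R * i'%:R) + 3 * (i%:R * t'%:R) = rhs by rewrite /lhs /rhs; ring.
by rewrite e e' !mulr0 !addr0.
Qed.

Definition twins a b c : bool := rootless a b c && rootless a b (c + 1).

(** This is [moment_identity] summed over all cubics. The sums of r and of n are both q^3, so 18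
    collects 9 + 9 from r and r', and 15 collects 3 + 3 from n and n' and the constant 9. *)
Lemma card_twins_moments :
  (9 * sum3 (fun a b c => twins a b c) +
     sum3 (fun a b c => ncubes a b c * ncubes a b (c + 1)%R) +
     6 * (q * (q.-1 * q.-1)) + 18 * q ^ 3 =
   sum3 (fun a b c => nsplits a b c * nsplits a b (c + 1)%R) +
     9 * (q ^ 2 * q.-1) + 15 * q ^ 3)%N.
Proof.
have [k k3] : {k | k = 3%N} by exists 3%N.
have [l l9] : {l | l = 9%N} by exists 9%N.
have H := eq_sum3 (fun a b c => moment_identity (cubic_count a b c)
  (cubic_count a b (c + 1)) (ncubes_rootless_succ a b c)
  (rootless_ncubes_succ a b c)).
rewrite -l9 -k3 !sum3D !sum3Z sum3_const in H.
rewrite (sum3_nsplits_nroots (oner_neq0 F)) (sum3_nroots_nsplits (oner_neq0 F)) in H.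
rewrite (sum3_nroots_nroots (oner_neq0 F)) in H.
rewrite (sum3_shift 1 (@nroots)) (sum3_shift 1 (@nsplits)) in H.
rewrite sum3_nroots1 sum3_nsplits1 k3 l9 in H.
rewrite (@eq_sum3 _ (fun a b c => rootless a b c * rootless a b (c + 1)%R)%N); first by lia.
by move=> a b c; rewrite mulnb.
Qed.

End Cubics.

(** * Divisibility of q by 3 and injectivity of cubing *)

Section FieldCard.
Variable F : finFieldType.
Local Notation q := #|F|.

(** Translation by 1 permutes the field, yet it raises the sum of all elements by q. *)
Lemma natr_card_eq0 : q%:R = 0 :> F.
Proof.
have : \sum_(x : F) x = \sum_(x : F) (1 + x) by rewrite (reindex_inj (addrI 1)).
by rewrite big_split /= sumr_const => /eqP; rewrite eq_sym -subr_eq0 addrK => /eqP.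
Qed.

Lemma three_neq0 : ~~ (3 %| q)%N -> 3 != 0 :> F.
Proof.
move=> n3; apply/eqP => t0; have := natr_card_eq0.
rewrite [in q%:R](divn_eq q 3) natrD natrM t0 mulr0 add0r.
have: (q %% 3 < 3)%N by rewrite ltn_mod.
move: n3; rewrite /dvdn; case: (q %% 3)%N => [|[|[|]]] // _ _.
  by move/eqP; rewrite oner_eq0.
move=> t2; have: 3 - 2 = 1 :> F by ring.
by rewrite t0 t2 subrr => /esym/eqP; rewrite oner_eq0.
Qed.

(** Cauchy's theorem in the additive group gives an element x of order 3, so 3 x = 0 with x
    nonzero. *)
Lemma three_eq0 : (3 %| q)%N -> 3 = 0 :> F.
Proof.
rewrite -cardsT => d3; have [x _ ox] := @Cauchy _ 3 [set: F]%G isT d3.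
have : 3 * (x : F) = 0 by rewrite mulr_natl -FinRing.zmodXgE -ox expg_order.
move/eqP; rewrite mulf_eq0 => /orP[/eqP //|/eqP x0].
by move: ox; rewrite x0 -FinRing.zmod1gE order1.
Qed.

Lemma cube_inj : (q %% 3 != 1)%N -> injective (fun x : F => x ^+ 3).
Proof.
move=> q1; have: (q %% 3 < 3)%N by rewrite ltn_mod.
case E: (q %% 3)%N q1 => [|[|[|]]] // _ _ x y /= xy.
  have t0 : 3 = 0 :> F by apply: three_eq0; rewrite /dvdn E.
  have : (x - y) ^+ 3 = x ^+ 3 - y ^+ 3 - 3 * (x * y * (x - y)) by ring.
  by rewrite xy t0 subrr mul0r subrr => /eqP; rewrite expf_eq0 subr_eq0 => /andP[_ /eqP].
(* For q = 2 mod 3 the exponent 2 q - 1 is divisible by 3, and z^(2 q - 1) = z^(q - 1) z^q = z holds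
   even at z = 0. Hence raising to the power (2 q - 1) / 3 inverts cubing. *)
have cE (z : F) : z = (z ^+ 3) ^+ ((2 * q - 1) %/ 3).
  rewrite -exprM mulnC divnK; last by rewrite /dvdn; lia.
  have -> : (2 * q - 1 = q.-1 + q)%N by have := finNzRing_gt1 F; lia.
  rewrite exprD expf_card -exprSr prednK ?expf_card //.
  by have := finNzRing_gt1 F; lia.
by rewrite (cE x) xy -cE.
Qed.
End FieldCard.

(** * Irreducible cubics and points of the elliptic curve *)

Section Bridge.
Variable F : finFieldType.
Implicit Types a b c : F.
Local Notation q := #|F|.

Definition cubic_poly a b c : {poly F} := Poly [:: c; b; a; 1].

Lemma cubic_poly_seq a b c : cubic_poly a b c = [:: c; b; a; 1] :> seq F.
Proof. by rewrite (PolyK (c := 0)) //= oner_eq0. Qed.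

Lemma size_cubic_poly a b c : size (cubic_poly a b c) = 4%N.
Proof. by rewrite cubic_poly_seq. Qed.

Lemma cubic_poly_horner a b c x : (cubic_poly a b c).[x] = cubic a b c x.
Proof. by rewrite horner_Poly /= /cubic; ring. Qed.

Lemma irreducible_cubic a b c :
  irreducible_poly (cubic_poly a b c) <-> rootless a b c.
Proof.
split=> [[_ irr]|nr].
  apply/forallP => x; apply/eqP; rewrite -cubic_poly_horner => /eqP x0.
  have := irr ('X - x%:P); rewrite size_XsubC dvdp_XsubCl rootE x0 => /(_ isT isT).
  by move/eqp_size; rewrite size_XsubC size_cubic_poly.
apply: cubic_irreducible; first by rewrite size_cubic_poly.
by move=> x; rewrite rootE cubic_poly_horner (forallP nr).
Qed.

Lemma cubic_poly_add1 a b c : cubic_poly a b c + 1 = cubic_poly a b (c + 1).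
Proof.
apply/polyP => i; rewrite coefD !coef_Poly coef1.
by case: i => [|[|[|[|i]]]] //=; rewrite ?addr0 // nth_nil.
Qed.

Definition cubic_npoly (p : F * F * F) : {poly_4 F} :=
  NPoly (eq_leq (size_cubic_poly p.1.1 p.1.2 p.2)).

Lemma cubic_npoly_inj : injective cubic_npoly.
Proof.
move=> [[a b] c] [[a' b'] c'] /(congr1 val) /= /(congr1 (@polyseq F)).
by rewrite !cubic_poly_seq => -[-> -> ->].
Qed.

Lemma pi3_01_sum3 : pi3_01 F = sum3 (fun a b c => twins a b c).
Proof.
rewrite /pi3_01 /sum3 pair_big pair_big /= sum_pred_card -(card_imset _ cubic_npoly_inj).
apply: eq_card => p; rewrite inE; apply/and4P/imsetP.
  move=> [mon /eqP sz /asboolP irr1 /asboolP irr2].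
  have pE : val p = cubic_poly p`_2 p`_1 p`_0.
    apply/polyP => i; rewrite coef_Poly; case: i => [|[|[|[|i]]]] //=.
      by move: mon; rewrite monicE lead_coefE sz => /eqP.
    by rewrite nth_nil nth_default // sz.
  exists (p`_2, p`_1, p`_0); last exact: val_inj.
  rewrite inE /= /twins; apply/andP; split; apply/irreducible_cubic.
    by rewrite -pE.
  by rewrite -cubic_poly_add1 -pE.
move=> [[[a b] c]]; rewrite inE /= => /andP[r1 r2] ->.
split=> /=.
- by rewrite monicE lead_coefE size_cubic_poly cubic_poly_seq.
- by rewrite size_cubic_poly.
- by apply/asboolP/irreducible_cubic.
- by apply/asboolP; rewrite cubic_poly_add1; apply/irreducible_cubic.
Qed.

(** If f = (T - x)^3 and f + 1 = (T - y)^3, the coefficient of T^2 forces x = y when 3 is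
    invertible, and the constant terms then give 1 = 0. *)
Lemma sum3_ncubes_ncubes0 : 3 != 0 :> F ->
  sum3 (fun a b c => ncubes a b c * ncubes a b (c + 1)%R)%N = 0%N.
Proof.
move=> t0; rewrite (sum3_ncubes (fun a b c => ncubes a b (c + 1))).
rewrite big1 // => x _; rewrite /ncubes sum_pred0_nat // => y /=.
apply/negP => /and3P[/eqP/oppr_inj/(mulfI t0) <- _].
by rewrite -subr_eq0 addrAC subrr add0r oner_eq0.
Qed.

(** In characteristic 3, (T - x)^3 + 1 = (T - (x - 1))^3, so every cube is followed by exactly one
    cube. *)
Lemma sum3_ncubes_ncubes_char3 : 3 = 0 :> F ->
  sum3 (fun a b c => ncubes a b c * ncubes a b (c + 1)%R)%N = q.
Proof.
move=> t0; rewrite (sum3_ncubes (fun a b c => ncubes a b (c + 1))).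
rewrite -[RHS]sum1_card; apply: eq_bigr => x _.
rewrite /ncubes (@sum_pred1_nat _ _ (x - 1)) // => y /=.
rewrite t0 !mul0r !eqxx /=.
have -> : (- x ^+ 3 + 1 == - y ^+ 3) = (y ^+ 3 - x ^+ 3 + 1 == 0).
  by rewrite -subr_eq0; congr (_ == 0); ring.
have -> : y ^+ 3 - x ^+ 3 + 1 =
    (y - (x - 1)) ^+ 3 + 3 * (y * (y - (x - 1)) * (x - 1) - x ^+ 2 + x) by ring.
by rewrite t0 mul0r addr0 expf_eq0 subr_eq0.
Qed.

Definition affine_E : nat :=
  (\sum_(x : F) \sum_(y : F) (x ^+ 3 == y * (y - 1))%R)%N.

(** A point with Z != 0 scales to Z = 1 and is affine. For Z = 0 the equation forces X = 0, which
    leaves the single point [0 : 1 : 0], encoded as [None]. *)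
Lemma card_E_points : #|E_points F| = affine_E.+1.
Proof.
pose vec (x y z : F) : 'rV[F]_3 := \row_(i < 3) [:: x; y; z]`_i.
have vecE (v : 'rV[F]_3) : v = vec (v 0 0) (v 0 1) (v 0 2%:R).
  apply/rowP => i; rewrite mxE; case: i => [[|[|[|i]]] lt] //=;
    congr (v _ _); exact/val_inj.
pose pt (p : option (F * F)) : 'M[F]_3 :=
  if p is Some (x, y) then <<vec x y 1>>%MS else <<vec 0 1 0>>%MS.
have eqP' (v w : 'rV[F]_3) : <<v>>%MS = <<w>>%MS -> exists a, v = a *: w.
  by move/genmxP/andP => [/sub_rVP].
have vec2 x y z : vec x y z 0 2%:R = z by rewrite mxE.
have vec1 x y z : vec x y z 0 1 = y by rewrite mxE.
have vec0 x y z : vec x y z 0 0 = x by rewrite mxE.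
have scE k (v : 'rV[F]_3) i : (k *: v) 0 i = k * v 0 i by rewrite mxE.
have pt_inj : injective pt.
  move=> [[x y]|] [[x' y']|] //= /eqP' [k vE].
  - have := congr1 (fun v : 'rV[F]_3 => v 0 2%:R) vE.
    cbv beta; rewrite scE !vec2 mulr1 => k1; rewrite -k1 scale1r in vE.
    have -> : x = x' by rewrite -[LHS](vec0 x y 1) vE vec0.
    by have -> : y = y' by rewrite -[LHS](vec1 x y 1) vE vec1.
  - have := congr1 (fun v : 'rV[F]_3 => v 0 2%:R) vE.
    by cbv beta; rewrite scE !vec2 mulr0 => /eqP; rewrite oner_eq0.
  - have := congr1 (fun v : 'rV[F]_3 => v 0 2%:R) vE.
    cbv beta; rewrite scE !vec2 mulr1 => k0; rewrite -k0 scale0r in vE.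
    have := congr1 (fun v : 'rV[F]_3 => v 0 1) vE.
    by cbv beta; rewrite vec1 mxE => /eqP; rewrite oner_eq0.
pose A := [pred p : option (F * F) |
  if p is Some (x, y) then x ^+ 3 == y * (y - 1) else true].
have -> : affine_E.+1 = #|A|.
  rewrite /affine_E pair_big /= -sum_pred_card (bigD1 None) //= add1n; congr _.+1.
  rewrite [RHS](reindex_omap Some id) /=; last by case.
  by apply: eq_big => [[x y]|[x y] _]; rewrite ?eqxx.
rewrite -(card_imset _ pt_inj); apply: eq_card => M; apply/imsetP/imsetP.
  move=> [v]; rewrite inE => /andP[v0 /eqP vE] ->.
  have [z0|z0] := eqVneq (v 0 2%:R) 0.
    exists None => //=; move: vE; rewrite z0 mulr0 => /eqP; rewrite expf_eq0 /= => /eqP x0.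
    have y0 : v 0 1 != 0.
      apply: contraNneq v0 => y0; rewrite (vecE v) x0 y0 z0.
      by apply/eqP/rowP => i; rewrite !mxE; case: i => [[|[|[|]]]].
    apply/genmxP/andP; split; apply/sub_rVP.
      exists (v 0 1); rewrite {1}(vecE v) x0 z0; apply/rowP => i; rewrite !mxE.
      by case: i => [[|[|[|]]]] //= _; rewrite ?mulr0 ?mulr1.
    exists (v 0 1)^-1; rewrite [in RHS](vecE v) x0 z0; apply/rowP => i; rewrite !mxE.
    by case: i => [[|[|[|]]]] //= _; rewrite ?mulr0 ?mulVf.
  exists (Some (v 0 0 / v 0 2%:R, v 0 1 / v 0 2%:R)).
    rewrite inE /=; apply/eqP; rewrite expr_div_n vE; by field.
  apply/genmxP/andP; split; apply/sub_rVP.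
    exists (v 0 2%:R); rewrite {1}(vecE v); apply/rowP => i; rewrite !mxE.
    by case: i => [[|[|[|]]]] //= _; rewrite ?mulr1 // mulrC divfK.
  exists (v 0 2%:R)^-1; rewrite [X in _ = _ *: X](vecE v); apply/rowP => i; rewrite !mxE.
  by case: i => [[|[|[|]]]] //= _; rewrite ?mulVf // mulrC.
move=> [[[x y]|]]; last move=> _ ->.
  rewrite inE /= => /eqP xy ->; exists (vec x y 1) => //; rewrite inE; apply/andP; split.
    by apply: contraTneq (oner_neq0 F) => v0; rewrite -(vec2 x y 1) v0 mxE eqxx.
  by rewrite /on_E vec0 vec1 vec2 xy mulr1.
exists (vec 0 1 0) => //; rewrite inE; apply/andP; split.
  by apply: contraTneq (oner_neq0 F) => v0; rewrite -(vec1 0 1 0) v0 mxE eqxx.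
by rewrite /on_E vec0 vec1 vec2 mulr0 expr0n.
Qed.

End Bridge.

(** * Cubic residues and cyclotomic numbers *)

(** The map is the discrete logarithm to the base of a primitive root, taken modulo 3. Exponents are
    defined modulo q - 1, which is a multiple of 3. *)
Lemma cubic_log_exists (F : finFieldType) : (#|F| %% 3 = 1)%N ->
  exists L : F -> 'Z_3,
  [/\ forall x y, x != 0 -> y != 0 -> L (x * y) = L x + L y,
      forall x, x != 0 -> (L x = 0 <-> exists y, x = y ^+ 3)
    & exists2 g, g != 0 & L g = 1].
Proof.
move=> q1; set n := #|F|.-1.
have q_gt1 : (1 < #|F|)%N := finNzRing_gt1 F.
have nE : (#|F| = n.+1)%N by rewrite /n; lia.
have n3 : (n %% 3 = 0)%N by lia.
have n_gt0 : (0 < n)%N by lia.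
have fermat (x : F) : x != 0 -> x ^+ n = 1.
  move=> x0; apply: (mulfI x0); rewrite mulr1 -exprS -nE; exact: expf_card.
have : has n.-primitive_root (filter (predC1 0) (enum F)).
  apply: has_prim_root => //.
  - by apply/allP => x; rewrite mem_filter /= => /andP[x0 _]; rewrite unity_rootE fermat.
  - by rewrite filter_uniq ?enum_uniq.
  - have -> : filter (predC1 0) (enum F) = enum (predC1 (0 : F)).
      by rewrite {2}/enum_mem -enumT; apply: eq_filter.
    by rewrite -cardE cardC1.
case/hasP => g _ pg.
have g0 : g != 0.
  apply/eqP => g0; have := prim_expr_order pg; rewrite g0 expr0n.
  by case: (n) n_gt0 => //= k _ /esym/eqP; rewrite oner_eq0.
(* The default 0 is taken only at x = 0, which is no power of g. *)
pose L (x : F) : 'Z_3 := if [pick i : 'I_n | x == g ^+ i] is Some i then (i : nat)%:R else 0.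
have LX k : L (g ^+ k) = k%:R.
  rewrite /L; case: pickP => [i|/(_ (Ordinal (ltn_pmod k n_gt0)))] /=; last first.
    by rewrite prim_expr_mod ?eqxx.
  rewrite (eq_prim_root_expr pg) => /eqP ki; apply: val_inj.
  rewrite !Zp_nat /= -(modn_dvdm (m := n)); last by rewrite /dvdn n3.
  by rewrite -ki modn_dvdm // /dvdn n3.
have gP x : x != 0 -> exists k, x = g ^+ k.
  by move=> /fermat /(prim_rootP pg) [i ->]; exists i.
exists L; split.
- move=> x y /gP[k ->] /gP[l ->]; by rewrite -exprD !LX natrD.
- move=> x /gP[k ->]; rewrite LX; split=> [k0|[y yE]].
    have /eqP k3 : (k %% 3 == 0)%N by have := congr1 val k0; rewrite Zp_nat /= => ->.
    by exists (g ^+ (k %/ 3)); rewrite -exprM divnK // /dvdn k3.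
  have y0 : y != 0.
    apply: contraTneq (expf_neq0 k g0) => y0.
    by rewrite yE y0 expr0n eqxx.
  have [l yl] := gP y y0.
  rewrite -(LX k) yE yl -exprM LX; apply: val_inj; rewrite Zp_nat /=.
  by rewrite modnMl.
- by exists g => //; rewrite -[g]expr1 LX.
Qed.

Lemma sumZ3 (G : 'Z_3 -> nat) : (\sum_k G k = G 0%R + G 1%R + G 2%R)%N.
Proof.
rewrite !big_ord_recl big_ord0 addn0 addnA.
by congr (G _ + G _ + G _)%N; apply: val_inj.
Qed.

Lemma Z3P (k : 'Z_3) : [\/ k = 0, k = 1 | k = 2].
Proof.
by case: k => [[|[|[|i]]] ltk] //;
  [apply: Or31|apply: Or32|apply: Or33]; apply: val_inj.
Qed.

(** The maps need to be mutually inverse only where [P] and [Q] hold: the changes of variables below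
    are fractional and break down elsewhere. *)
Lemma sum_bij (S T : finType) (P : pred S) (Q : pred T) (f : S -> T) (g : T -> S) :
    (forall x, P x -> Q (f x) /\ g (f x) = x) ->
    (forall y, Q y -> P (g y) /\ f (g y) = y) ->
  (\sum_x P x = \sum_y Q y)%N.
Proof.
move=> Pf Qg; rewrite !sum_pred_card; apply/eqP; rewrite eqn_leq; apply/andP; split.
  rewrite -(@card_in_imset _ _ f [pred x | P x]).
    by apply/subset_leq_card/subsetP => y /imsetP[x]; rewrite !inE => /Pf[Qx _] ->.
  by move=> x y; rewrite !inE => /Pf[_ gx] /Pf[_ gy] /(congr1 g); rewrite gx gy.
rewrite -(@card_in_imset _ _ g [pred x | Q x]).
  by apply/subset_leq_card/subsetP => y /imsetP[x]; rewrite !inE => /Qg[Qx _] ->.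
by move=> x y; rewrite !inE => /Qg[_ gx] /Qg[_ gy] /(congr1 f); rewrite gx gy.
Qed.

Section CubicLog.
Variables (F : finFieldType) (L : F -> 'Z_3).
Hypothesis q1 : (#|F| %% 3 = 1)%N.
Hypothesis LM : forall x y, x != 0 -> y != 0 -> L (x * y) = L x + L y.
Hypothesis L_cube : forall x, x != 0 -> (L x = 0 <-> exists y, x = y ^+ 3).
Hypothesis L_surj : exists2 g, g != 0 & L g = 1.
Implicit Types (c d g h m n s t u x y z : F) (i j k l : 'Z_3).
Local Notation q := #|F|.
Local Notation third := (q.-1 %/ 3)%N.

Let q_gt1 : (1 < q)%N := finNzRing_gt1 F.
Let qE : (q = 3 * third + 1)%N.
Proof. lia. Qed.

Lemma cubic_logV x : x != 0 -> L x^-1 = - L x.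
Proof.
move=> x0; apply/eqP; rewrite -addr_eq0 -LM ?invr_neq0 // mulVf //; apply/eqP.
by apply/L_cube; [exact: oner_neq0|exists 1; rewrite expr1n].
Qed.

Lemma cubic_logN1 : L (- 1) = 0.
Proof. by apply/L_cube; [rewrite oppr_eq0 oner_neq0|exists (-1); ring]. Qed.

Lemma cubic_logN x : x != 0 -> L (- x) = L x.
Proof.
by move=> x0; rewrite -mulN1r LM ?oppr_eq0 ?oner_eq0 // cubic_logN1 add0r.
Qed.

(** Multiplication by an element of logarithm 1 permutes the three classes cyclically, so they share
    the q - 1 nonzero elements equally. *)
Lemma cubic_log_class i : (\sum_x ((x != 0%R) && (L x == i)) = third)%N.
Proof.
have [g g0 g1] := L_surj.
pose N k := (\sum_x ((x != 0%R) && (L x == k)))%N.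
have step k : N (k + 1) = N k.
  rewrite /N (reindex_inj (mulfI g0)); apply: eq_bigr => x _ /=.
  rewrite mulf_eq0 negb_or g0 /=; have [->//|x0] := eqVneq x 0.
  by rewrite LM // g1 addrC (inj_eq (addIr 1)).
have N1 : N 1 = N 0 by rewrite -(step 0) add0r.
have N2 : N 2 = N 0 by rewrite -N1 -(step 1).
have Nk k : N k = N 0 by case: (Z3P k) => ->.
have : (\sum_k N k = q.-1)%N.
  rewrite /N exchange_big -(sum_predC1 (0 : F)); apply: eq_bigr => x _.
  have [->|x0] := eqVneq x 0; first by rewrite big1.
  by apply: (@sum_pred1_nat _ _ (L x)) => k /=; rewrite eq_sym.
rewrite sumZ3 N1 N2 => E; rewrite -[LHS]/(N i) Nk; lia.
Qed.

(** Each nonzero cube has as many cube roots as 1 has, say K. Counting the nonzero elements by their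
    cubes gives K (q - 1) / 3 = q - 1, so K = 3. *)
Lemma sum_cube_roots x : x != 0 -> (\sum_y (y ^+ 3 == x)%R = 3 * (L x == 0%R))%N.
Proof.
pose K := (\sum_(u : F) (u ^+ 3 == 1)%R)%N.
have fib z : z != 0 -> (\sum_y (y ^+ 3 == z)%R = K * (L z == 0%R))%N.
  move=> z0; case: eqP => [/(L_cube z0)[y zy]|nL]; last first.
    rewrite muln0 sum_pred0_nat // => y /=; apply/eqP => yz; apply: nL.
    by apply/L_cube => //; exists y.
  have y0 : y != 0 by apply: contraNneq z0 => y0; rewrite zy y0 expr0n.
  rewrite muln1 (reindex_inj (mulfI y0)); apply: eq_bigr => u _.
  by rewrite exprMn zy -[X in _ == X]mulr1 (inj_eq (mulfI (expf_neq0 3 y0))).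
suff K3 : K = 3%N by move=> x0; rewrite (fib x x0) K3.
have : (\sum_(z : F | z != 0%R) \sum_y (y ^+ 3 == z)%R = q.-1)%N.
  rewrite exchange_big -(sum_predC1 (0 : F)); apply: eq_bigr => y _ /=.
  have [->|y0] := eqVneq y 0.
    by rewrite big1 // => z z0; rewrite expr0n eq_sym (negPf z0).
  rewrite (bigD1 (y ^+ 3)) ?expf_neq0 //= eqxx big1 // => z /andP[_].
  by rewrite eq_sym => /negPf->.
rewrite (eq_bigr _ fib) -big_distrr /= big_mkcond /=.
rewrite (eq_bigr (fun z => nat_of_bool ((z != 0) && (L z == 0)))) => [|z _]; last by case: (z != 0).
rewrite cubic_log_class => KE; apply/eqP.
have t_gt0 : (0 < third)%N by lia.
rewrite -(eqn_pmul2r t_gt0) KE; by rewrite {1}qE addn1.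
Qed.

Definition unit2 c : bool := (c != 0) && (c + 1 != 0).

Definition cyclo i j : nat :=
  (\sum_c [&& unit2 c, L c == i & L (c + 1)%R == j])%N.

Lemma sum_cyclo (G : 'Z_3 -> 'Z_3 -> nat) :
  (\sum_c unit2 c * G (L c) (L (c + 1)%R) = \sum_i \sum_j cyclo i j * G i j)%N.
Proof.
rewrite /cyclo.
under [RHS]eq_bigr => i _ do under eq_bigr => j _ do rewrite big_distrl /=.
under [RHS]eq_bigr => i _ do rewrite exchange_big /=.
rewrite [RHS]exchange_big; apply: eq_bigr => c _ /=.
case: (unit2 c) => /=; last by rewrite !big1 // => i _; rewrite big1.
under [RHS]eq_bigr => i _ do under eq_bigr => j _ do rewrite -mulnb -mulnA.
under [RHS]eq_bigr => i _ do rewrite -big_distrr /=.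
rewrite mul1n (@sum_pred1_mul _ _ (L c)) => [|i /=]; last by rewrite eq_sym.
by rewrite (@sum_pred1_mul _ _ (L (c + 1))) // => j /=; rewrite eq_sym.
Qed.

(** The substitution of -(c + 1) for c exchanges c and c + 1 up to sign, and -1 is a cube. *)
Lemma cycloC i j : cyclo i j = cyclo j i.
Proof.
have inj : injective (fun c => - (c + 1)) by move=> c d /oppr_inj/addIr.
rewrite /cyclo (reindex_inj inj); apply: eq_bigr => c _ /=; rewrite /unit2.
have -> : - (c + 1) + 1 = - c by ring.
rewrite !oppr_eq0; have [->|c0] := eqVneq c 0; first by rewrite andbF.
have [->//|c1] := eqVneq (c + 1) 0.
by rewrite !cubic_logN //= andbC.
Qed.

(** Substitute 1 / c for c and use 1 / c + 1 = (c + 1) / c. *)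
Lemma cycloV i j : cyclo i j = cyclo (- i) (j - i).
Proof.
rewrite /cyclo (reindex_inj invr_inj); apply: eq_bigr => c _ /=; rewrite /unit2.
rewrite invr_eq0; have [->//|c0] := eqVneq c 0.
have -> : c^-1 + 1 = (c + 1) * c^-1 by field.
rewrite mulf_eq0 invr_eq0 (negPf c0) orbF; have [->//|c1 /=] := eqVneq (c + 1) 0.
rewrite LM ?invr_neq0 // cubic_logV // eqr_oppLR; congr nat_of_bool.
by case: eqP => //= ->; rewrite opprK -[RHS](inj_eq (addIr i)) subrK.
Qed.

(** Every c of class i is sorted by the class of c + 1, except c = -1, which lies in class 0. *)
Lemma cyclo_row i : (\sum_j cyclo i j + (i == 0%R) = third)%N.
Proof.
rewrite -(cubic_log_class i) /cyclo exchange_big /= (bigD1 (- 1)) //=.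
rewrite [RHS](bigD1 (- 1)) //= oppr_eq0 oner_eq0 /= cubic_logN1 eq_sym.
rewrite {1}/unit2 addNr eqxx andbF /= big1 // add0n addnC; congr addn.
apply: eq_bigr => c c1; rewrite /unit2 addr_eq0 c1 andbT.
case: (c != 0) => //=; last by rewrite big1.
case: (L c == i) => //=; last by rewrite big1.
by apply: (@sum_pred1_nat _ _ (L (c + 1))) => j /=; rewrite eq_sym.
Qed.

Local Notation A := (cyclo 0 0).
Local Notation B := (cyclo 1 1).
Local Notation C := (cyclo 2 2).
Local Notation D := (cyclo 1 2).

Lemma cyclo_values :
  [/\ cyclo 0 2 = B, cyclo 2 0 = B, cyclo 0 1 = C, cyclo 1 0 = C & cyclo 2 1 = D].
Proof.
have e1 : cyclo 2 0 = B by rewrite cycloV; congr cyclo; apply: val_inj.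
have e2 : cyclo 1 0 = C by rewrite cycloV; congr cyclo; apply: val_inj.
by split=> //; rewrite cycloC.
Qed.

Lemma cyclo_relations : (A + B + C + 1 = third)%N /\ (B + C + D = third)%N.
Proof.
have [e1 e2 e3 e4 e5] := cyclo_values.
have := cyclo_row 0; have := cyclo_row 1; rewrite !sumZ3 e1 e3 e4 /=; lia.
Qed.

Lemma sum_by_log (P : pred F) (f : F -> 'Z_3) (G : 'Z_3 -> nat) :
  (\sum_x P x * G (f x) = \sum_j (\sum_x (P x && (f x == j))) * G j)%N.
Proof.
under [RHS]eq_bigr => j _ do rewrite big_distrl /=.
rewrite [RHS]exchange_big; apply: eq_bigr => x _ /=.
case: (P x) => /=; last by rewrite big1.
by rewrite mul1n (@sum_pred1_mul _ _ (f x)) // => j /=; rewrite eq_sym.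
Qed.

Ltac decide_bools :=
  repeat match goal with |- context [nat_of_bool ?b] =>
    first [change (nat_of_bool b) with 1%N | change (nat_of_bool b) with 0%N] end.

(** The coefficient of w^k in the Jacobi sum of chi(c) chi(c + 1), where chi = w^L and w is a
    primitive cube root of unity. *)
Definition jclass k : nat := (\sum_c (unit2 c && (L c + L (c + 1) == k)%R))%N.

Lemma jclassE : [/\ jclass 0 = (A + 2 * D)%N, jclass 1 = (3 * C)%N & jclass 2 = (3 * B)%N].
Proof.
have [e1 e2 e3 e4 e5] := cyclo_values.
have E k : jclass k = (\sum_i \sum_j cyclo i j * (i + j == k)%R)%N.
  by rewrite -(sum_cyclo (fun i j => i + j == k)); apply: eq_bigr => c _; rewrite mulnb.
by split; rewrite E !sumZ3 e1 e2 e3 e4 e5; decide_bools; lia.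
Qed.

Definition not01 t : bool := (t != 0) && (t != 1).

Lemma not01_class k : (\sum_t (not01 t && (L t == k)) + (k == 0%R) = third)%N.
Proof.
rewrite -(cubic_log_class k) (bigD1 1) //= [RHS](bigD1 1) //=.
have -> : L 1 = 0 by apply/L_cube; [exact: oner_neq0 | exists 1; rewrite expr1n].
rewrite /not01 eqxx andbF oner_neq0 /= add0n addnC eq_sym; congr addn.
by apply: eq_bigr => t ->; rewrite andbT.
Qed.

Lemma card_unit2 : (\sum_c unit2 c = q - 2)%N.
Proof.
rewrite -(@sum_notin _ [:: 0; - 1 : F]); last by rewrite /= inE eq_sym oppr_eq0 oner_eq0.
by apply: eq_bigr => c _; rewrite !inE negb_or /unit2 addr_eq0.
Qed.

(* [c / d] and [(c + 1) / (d + 1)] are free coordinates on pairs [c != d]; in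
   them the Jacobi sum times its conjugate becomes a product of character sums. *)
Lemma jacobi_pairs k :
  (\sum_(p : F * F) [&& unit2 p.1, unit2 p.2, p.1 != p.2 &
     L p.1 + L (p.1 + 1)%R == L p.2 + L (p.2 + 1) + k]%R =
   \sum_(p : F * F) [&& not01 p.1, not01 p.2, p.1 != p.2 & L p.1 + L p.2 == k]%R)%N.
Proof.
pose f (p : F * F) := (p.1 / p.2, (p.1 + 1) / (p.2 + 1)).
(* Solving c = t d and c + 1 = u (d + 1) gives d = (u - 1) / (t - u). *)
pose g (p : F * F) := (p.1 * ((p.2 - 1) / (p.1 - p.2)), (p.2 - 1) / (p.1 - p.2)).
apply: (@sum_bij _ _ _ _ f g) => [[c d]|[t u]] /=.
  move=> /and4P[/andP[c0 c1] /andP[d0 d1] cd /eqP Lk].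
  have cd0 : c - d != 0 by rewrite subr_eq0.
  have tE : c / d - 1 = (c - d) / d by field.
  have uE : (c + 1) / (d + 1) - 1 = (c - d) / (d + 1) by field.
  have tuE : c / d - (c + 1) / (d + 1) = (c - d) / (d * (d + 1)).
    by field; rewrite d1.
  split.
    apply/and4P; split.
    - rewrite /not01 mulf_neq0 ?invr_eq0 //= -subr_eq0 tE.
      by rewrite mulf_neq0 ?invr_eq0.
    - rewrite /not01 mulf_neq0 ?invr_eq0 //= -subr_eq0 uE.
      by rewrite mulf_neq0 ?invr_eq0.
    - by rewrite -subr_eq0 tuE mulf_neq0 ?invr_eq0 ?mulf_neq0.
    - rewrite !LM ?invr_neq0 // !cubic_logV //.
      by rewrite addrACA Lk -opprD addrAC subrr add0r.
  rewrite /g /f /= uE tuE.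
  have -> : (c - d) / (d + 1) / ((c - d) / (d * (d + 1))) = d.
    by field; rewrite d0 d1 cd0.
  by congr (_, _); rewrite divfK.
move=> /and4P[/andP[t0 t1] /andP[u0 u1] tu /eqP Lk].
have tu0 : t - u != 0 by rewrite subr_eq0.
have t10 : t - 1 != 0 by rewrite subr_eq0.
have u10 : u - 1 != 0 by rewrite subr_eq0.
have dE : (u - 1) / (t - u) + 1 = (t - 1) / (t - u) by field.
have cE : t * ((u - 1) / (t - u)) + 1 = u * ((t - 1) / (t - u)) by field.
have d0 : (u - 1) / (t - u) != 0 by rewrite mulf_neq0 ?invr_eq0.
have d1 : (t - 1) / (t - u) != 0 by rewrite mulf_neq0 ?invr_eq0.
rewrite /f /g /=; move: ((u - 1) / (t - u)) ((t - 1) / (t - u)) dE cE d0 d1 => d e dE cE d0 d1.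
split; last by rewrite /= cE dE !mulfK.
rewrite /unit2 cE dE d0 d1 !mulf_neq0 //= !LM // addrACA Lk addrC eqxx andbT.
by rewrite -{2}[d]mul1r (inj_eq (mulIf d0)).
Qed.

(** For X_k = [jclass k], this says that X_0 + X_1 w + X_2 w^2, with w a primitive cube root of
    unity, has squared absolute value q. *)
Lemma jacobi_norm :
  (jclass 0%R ^ 2 + jclass 1%R ^ 2 + jclass 2%R ^ 2 =
   q + (jclass 0%R * jclass 1%R + jclass 1%R * jclass 2%R + jclass 2%R * jclass 0%R))%N.
Proof.
pose Y k := (\sum_t (not01 t && (L t == k)))%N.
have Y0 : (Y 0%R + 1 = third)%N := not01_class 0.
have Y1 : (Y 1%R + 0 = third)%N := not01_class 1.
have Y2 : (Y 2%R + 0 = third)%N := not01_class 2.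
have W k : (\sum_(p : F * F) [&& unit2 p.1, unit2 p.2 &
     L p.1 + L (p.1 + 1)%R == L p.2 + L (p.2 + 1) + k]%R =
     \sum_j jclass j * jclass (j + k)%R)%N.
  rewrite /jclass -(sum_by_log unit2 (fun c => L c + L (c + 1)) (fun j => jclass (j + k))).
  rewrite -(pair_bigA _ (fun c d => nat_of_bool [&& unit2 c, unit2 d &
     L c + L (c + 1)%R == L d + L (d + 1) + k])) /= exchange_big.
  apply: eq_bigr => d _; rewrite big_distrr; apply: eq_bigr => c _ /=.
  by case: (unit2 c); case: (unit2 d); rewrite /= ?mul1n ?mul0n.
have V k : (\sum_(p : F * F) [&& not01 p.1, not01 p.2 & L p.1 + L p.2 == k]%R =
     \sum_j Y j * Y (k - j)%R)%N.
  rewrite -(sum_by_log not01 L (fun j => Y (k - j))).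
  rewrite -(pair_bigA _ (fun c d => nat_of_bool [&& not01 c, not01 d & L c + L d == k])) /=.
  apply: eq_bigr => d _; rewrite big_distrr; apply: eq_bigr => c _ /=.
  have -> : (L d + L c == k) = (L c == k - L d).
    by apply/eqP/eqP => [<-|->]; [rewrite addrAC subrr add0r | rewrite addrCA subrr addr0].
  by case: (not01 c); case: (not01 d); rewrite /= ?mul1n ?mul0n.
have diag (P : pred (F * F)) :
    (\sum_p P p = \sum_c P (c, c) + \sum_p ((p.1 != p.2) && P p))%N.
  rewrite (bigID (fun p => p.1 == p.2)) /=; congr addn.
    rewrite (reindex_onto (fun c => (c, c)) fst) => [|[c d] /= /eqP-> //].
    by apply: eq_bigl => c; rewrite /= !eqxx.
  by rewrite big_mkcond; apply: eq_bigr => p _; case: eqP.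
(* Off the diagonal the two pair counts agree by [jacobi_pairs]. The diagonal c = d contributes only
   for k = 0, the diagonal t = u when 2 L(t) = k. *)
have main k : ((\sum_c (unit2 c && (k == 0%R))) + (\sum_j Y j * Y (k - j)%R) =
    \sum_j jclass j * jclass (j + k)%R + \sum_j Y j * (j + j == k)%R)%N.
  rewrite -W -V diag [X in (_ = X + _)%N]diag /=.
  have -> : (\sum_(p : F * F) ((p.1 != p.2) && [&& unit2 p.1, unit2 p.2 &
     L p.1 + L (p.1 + 1)%R == L p.2 + L (p.2 + 1) + k]%R) =
     \sum_(p : F * F) ((p.1 != p.2) && [&& not01 p.1, not01 p.2 & L p.1 + L p.2 == k]%R))%N.
    transitivity (\sum_(p : F * F) [&& unit2 p.1, unit2 p.2, p.1 != p.2 &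
     L p.1 + L (p.1 + 1)%R == L p.2 + L (p.2 + 1) + k]%R)%N.
      by apply: eq_bigr => p _; case: (p.1 != p.2); rewrite ?andbF.
    by rewrite jacobi_pairs; apply: eq_bigr => p _; case: (p.1 != p.2); rewrite ?andbF.
  have -> : (\sum_(c : F) [&& unit2 c, unit2 c & L c + L (c + 1)%R == L c + L (c + 1) + k]%R =
             \sum_c (unit2 c && (k == 0%R)))%N.
    apply: eq_bigr => c _; rewrite andbA andbb -[X in X == _]addr0.
    by rewrite (inj_eq (addrI _)) eq_sym.
  have -> : (\sum_(c : F) [&& not01 c, not01 c & L c + L c == k]%R =
             \sum_j Y j * (j + j == k)%R)%N.
    rewrite -(sum_by_log not01 L (fun j => j + j == k)).
    by apply: eq_bigr => c _; rewrite andbA andbb mulnb.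
  by rewrite addnA addnAC.
(* Subtracting the case k = 1 from k = 0 leaves the squares minus the mixed products of the [jclass]
   values. *)
have := main 0; have := main 1; rewrite !sumZ3 !eqxx; decide_bools.
have -> : (\sum_c (unit2 c && true) = q - 2)%N.
  by rewrite -card_unit2; apply: eq_bigr => c _; rewrite andbT.
rewrite big1 => [|c _]; last by rewrite andbF.
have t2 : 0 - 1 = 2 :> 'Z_3 by apply: val_inj.
have t3 : 0 - 2 = 1 :> 'Z_3 by apply: val_inj.
have t4 : 1 - 2 = 2 :> 'Z_3 by apply: val_inj.
have t5 : 1 + 1 = 2 :> 'Z_3 by apply: val_inj.
have t6 : 2 + 1 = 0 :> 'Z_3 by apply: val_inj.
rewrite t2 t3 t4 t5 t6 !subr0 !subrr !addr0 !add0r.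
set X0 := jclass 0; set X1 := jclass 1; set X2 := jclass 2.
have -> : Y 1 = third by lia.
have -> : Y 2 = third by lia.
have [r rE] : {r | r = Y 0} by exists (Y 0).
rewrite -rE in Y0 *; rewrite [in (q - 2)%N]qE [in (q + _)%N]qE -Y0; clear.
rewrite -!mulnn; nia.
Qed.

(** * Cardano's resolvent when q = 1 mod 3 *)

Lemma three_unit : 3 != 0 :> F.
Proof. by apply: three_neq0; rewrite /dvdn q1. Qed.

Definition depressed m n : bool := [forall x, x ^+ 3 - 3 * m * x - n != 0].

(** The coefficients are those of (T - h)^3 - 3 m (T - h) - n. *)
Lemma rootless_depressed (h m n : F) :
  rootless (- (3 * h)) (3 * h ^+ 2 - 3 * m) (- h ^+ 3 + 3 * m * h - n) = depressed m n.
Proof.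
apply/forallP/forallP => nr x.
  have := nr (x + h); congr (_ != 0); rewrite /cubic; ring.
have := nr (x - h); congr (_ != 0); rewrite /cubic; ring.
Qed.

Lemma sum3_depressed (G : F -> F -> F -> nat) :
  sum3 G = (\sum_h \sum_m \sum_n
    G (- (3 * h))%R (3 * h ^+ 2 - 3 * m)%R (- h ^+ 3 + 3 * m * h - n)%R)%N.
Proof.
have i1 : injective (fun h => - (3 * h)) by move=> h h' /oppr_inj/(mulfI three_unit).
rewrite /sum3 (reindex_inj i1); apply: eq_bigr => h _ /=.
have i2 : injective (fun m => 3 * h ^+ 2 - 3 * m).
  by move=> m m' /addrI/oppr_inj/(mulfI three_unit).
rewrite (reindex_inj i2); apply: eq_bigr => m _ /=.
have i3 : injective (fun n => - h ^+ 3 + 3 * m * h - n) by move=> n n' /addrI/oppr_inj.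
by rewrite (reindex_inj i3).
Qed.

Lemma card_depressed : (3 * (\sum_m \sum_n depressed m n) + 1 = q ^ 2)%N.
Proof.
have := card_rootless F; rewrite sum3_depressed.
under eq_bigr => h _ do under eq_bigr => m _ do under eq_bigr => n _ do
  rewrite rootless_depressed.
rewrite sum_nat_const -[X in (_ + X)%N]muln1 mulnCA -mulnDr expnS => /eqP.
by rewrite eqn_pmul2l ?(ltnW q_gt1) // => /eqP.
Qed.

Definition noncube z : bool := (z != 0) && (L z != 0).

(** Cardano's substitution x = s + m / s turns x^3 - 3 m x = n into z + m^3 / z = n for z = s^3. *)
Definition resolvent m n z : bool := noncube z && (z + m ^+ 3 / z == n).

Definition nresolvent m n : nat := (\sum_z resolvent m n z)%N.

Lemma card_noncube : (\sum_z noncube z = 2 * third)%N.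
Proof.
transitivity (\sum_z (((z != 0%R) && (L z == 1%R)) + ((z != 0%R) && (L z == 2%R))))%N.
  by apply: eq_bigr => z _; rewrite /noncube; case: (z != 0) => //=; case: (Z3P (L z)) => ->.
by rewrite big_split /= !cubic_log_class mul2n addnn.
Qed.

Lemma noncube_cube y : ~~ noncube (y ^+ 3).
Proof.
apply/andP => -[y0]; apply/negP; rewrite negbK.
by apply/eqP/L_cube => //; exists y.
Qed.

(* If [x] is a root and [z] a root of the resolvent, then [s] satisfies
   [s ^ 2 = x s - m], hence [s ^ 3 = z]. *)
Lemma resolvent_depressed m n z : resolvent m n z -> depressed m n.
Proof.
move=> /andP[nz /eqP zE]; apply/forallP => x; apply/negP => /eqP x0.
have z0 : z != 0 by case/andP: nz.
have nE : n = x ^+ 3 - 3 * m * x.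
  by apply/eqP; rewrite -subr_eq0 -oppr_eq0 opprB; apply/eqP.
have zq : z ^+ 2 - n * z + m ^+ 3 = 0 by rewrite -zE; field.
(* If x^2 = m, the resolvent has the double root -x^3, a cube. *)
have [xm|xm] := eqVneq (x ^+ 2) m.
  have : (z + x ^+ 3) ^+ 2 = 0 by rewrite -zq nE -xm; ring.
  move/eqP; rewrite expf_eq0 /= addr_eq0 => /eqP zx.
  have := noncube_cube (- x); suff -> : (- x) ^+ 3 = z by rewrite nz.
  by rewrite zx; ring.
have xm0 : x ^+ 2 - m != 0 by rewrite subr_eq0.
(* From s^2 = x s - m one gets s^3 = (x^2 - m) s - m x; setting this equal to z determines s. *)
pose s := (z + m * x) / (x ^+ 2 - m).
have sE : (x ^+ 2 - m) * s = z + m * x by rewrite /s mulrC divfK.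
have s2 : s ^+ 2 = x * s - m.
  apply: (mulfI (expf_neq0 2 xm0)).
  have -> : (x ^+ 2 - m) ^+ 2 * s ^+ 2 = ((x ^+ 2 - m) * s) ^+ 2 by ring.
  have -> : (x ^+ 2 - m) ^+ 2 * (x * s - m) =
     x * (x ^+ 2 - m) * ((x ^+ 2 - m) * s) - m * (x ^+ 2 - m) ^+ 2 by ring.
  rewrite sE; apply/eqP; rewrite -subr_eq0 -zq nE; apply/eqP; ring.
have := noncube_cube s; suff -> : s ^+ 3 = z by rewrite nz.
have -> : s ^+ 3 = s * s ^+ 2 by ring.
have -> : z = (x ^+ 2 - m) * s - m * x by rewrite sE addrK.
rewrite s2.
have -> : s * (x * s - m) = x * s ^+ 2 - m * s by ring.
by rewrite s2; ring.
Qed.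

Lemma nresolvent0 n : nresolvent 0 n = noncube n.
Proof.
rewrite /nresolvent (bigD1 n) //= big1 => [|z zn].
  by rewrite /resolvent expr0n mul0r addr0 eqxx andbT addn0.
by rewrite /resolvent expr0n mul0r addr0 (negPf zn) andbF.
Qed.

(** The roots of the resolvent are z and m^3 / z. Their logarithms are opposite, so both are
    noncubes or neither is; opposite nonzero logarithms modulo 3 differ, so two noncube roots are
    distinct. *)
Lemma nresolvent_pair m n : m != 0 ->
  nresolvent m n = (2 * (0 < nresolvent m n))%N.
Proof.
move=> m0; case: posnP => [->//|]; rewrite lt0n sum_nat_eq0 negb_forall.
move=> /existsP[z]; rewrite /= eqb0 negbK => /andP[nz /eqP zE].
have [z0 Lz] := andP nz.
have mz0 : m ^+ 3 / z != 0 by rewrite mulf_neq0 ?expf_neq0 ?invr_eq0.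
have Lm : L (m ^+ 3 / z) = - L z.
  rewrite LM ?expf_neq0 ?invr_eq0 // cubic_logV //.
  suff -> : L (m ^+ 3) = 0 by rewrite add0r.
  by apply/L_cube; [exact: expf_neq0 | exists m].
have nmz : noncube (m ^+ 3 / z) by rewrite /noncube mz0 Lm oppr_eq0.
have ne : z != m ^+ 3 / z.
  apply: contraNneq Lz => zm; rewrite {1}zm Lm.
  apply/eqP; have : L z = - L z by rewrite -Lm -zm.
  by case: (Z3P (L z)) => -> // /(congr1 val).
rewrite muln1 -(sum_roots2 ne) /nresolvent; apply: eq_bigr => y _; congr nat_of_bool.
apply/andP/eqP => [[/andP[y0 _] /eqP yE]|/eqP].
  have -> : (y - z) * (y - m ^+ 3 / z) = y * (y + m ^+ 3 / y - (z + m ^+ 3 / z)).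
    by field; rewrite z0.
  by rewrite yE zE subrr mulr0.
rewrite mulf_eq0 !subr_eq0 => /orP[/eqP->|/eqP->]; first by rewrite nz zE.
split=> //; rewrite -zE; apply/eqP; field; by rewrite z0 m0.
Qed.

Lemma sum_nresolvent m : (\sum_n nresolvent m n = 2 * third)%N.
Proof.
rewrite -card_noncube /nresolvent exchange_big; apply: eq_bigr => z _ /=.
rewrite /resolvent; case: (noncube z) => /=; last by rewrite big1.
by apply: (@sum_pred1_nat _ _ (z + m ^+ 3 / z)) => n /=; rewrite eq_sym.
Qed.

(** One implication is [resolvent_depressed]; the other follows by counting. Pairs (m, n) with a
    noncube resolvent root number (q - 1) / 3 for each m != 0 and 2 (q - 1) / 3 for m = 0. This adds
    up to (q^2 - 1) / 3, the number of rootless depressed cubics. *)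
Lemma depressedE m n : depressed m n = (0 < nresolvent m n)%N.
Proof.
have sub m' n' : (0 < nresolvent m' n')%N -> depressed m' n'.
  rewrite lt0n sum_nat_eq0 negb_forall => /existsP[z]; rewrite /= eqb0 negbK.
  exact: resolvent_depressed.
have row m' : m' != 0 -> (\sum_n' (0 < nresolvent m' n') = third)%N.
  move=> m0; have := sum_nresolvent m'.
  rewrite (eq_bigr _ (fun n' _ => nresolvent_pair n' m0)) -big_distrr /=.
  by move/eqP; rewrite eqn_pmul2l // => /eqP.
have tot : (\sum_m' \sum_n' (0 < nresolvent m' n') = q.-1 * third + 2 * third)%N.
  rewrite (bigD1 0) //= addnC; congr addn.
    rewrite (eq_bigr _ row) sum_nat_const; congr muln.
    by rewrite -(sum_predC1 (0 : F)) sum_pred_card; apply: eq_card.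
  by rewrite -card_noncube; apply: eq_bigr => n' _; rewrite nresolvent0 lt0b.
have eqs : (\sum_(p : F * F) (0 < nresolvent p.1 p.2) =
            \sum_(p : F * F) depressed p.1 p.2)%N.
  rewrite -(pair_bigA _ (fun a b => nat_of_bool (0 < nresolvent a b)%N)) /=.
  rewrite -(pair_bigA _ (fun a b => nat_of_bool (depressed a b))) /= tot.
  have := card_depressed; move: (\sum_m' \sum_n' depressed m' n')%N => Sd.
  have -> : q.-1 = (3 * third)%N by rewrite [in LHS]qE addn1.
  have -> : (q ^ 2 = (3 * third + 1) * (3 * third + 1))%N by rewrite -qE -mulnn.
  by move: third => t; nia.
move/eqP: eqs; rewrite eq_sym !sum_pred_card.
set Dp := [pred p : F * F | depressed p.1 p.2]; set Np := [pred p : F * F | _] => eqs.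
have /subset_cardP : #|Np| = #|Dp| by apply/esym/eqP.
have sND : Np \subset Dp by apply/subsetP => p; rewrite !inE; apply: sub.
by move=> /(_ sND) /(_ (m, n)); rewrite !inE.
Qed.

Lemma resolvent_pairs :
  (\sum_(p : F * F * F) [&& p.1.1 != 0%R, noncube p.1.2, noncube p.2 &
     p.1.2 + p.1.1 ^+ 3 / p.1.2 - 1 == p.2 + p.1.1 ^+ 3 / p.2]%R =
   \sum_(p : F * F * F) [&& unit2 p.1.2, unit2 p.2,
     p.1.1 ^+ 3 == p.1.2 * (p.1.2 + 1) * (p.2 * (p.2 + 1)),
     L (p.1.2 + 1) + L (p.2 + 1) != 0 & L p.1.2 + L (p.2 + 1) != 0]%R)%N.
Proof.
pose f (p : F * F * F) : F * F * F :=
  (p.1.1, p.2 / (p.1.2 - p.2), p.1.1 ^+ 3 / (p.1.2 * p.2 - p.1.1 ^+ 3)).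
pose g (p : F * F * F) : F * F * F :=
  (p.1.1, (p.1.2 + 1) * (p.2 + 1), p.1.2 * (p.2 + 1)).
apply: (@sum_bij _ _ _ _ f g) => [[[m z] y]|[[m c] d]] /=.
  move=> /and4P[m0 /andP[z0 Lz] /andP[y0 Ly] /eqP E].
  (* This is the equation between z and y with denominators cleared. It shows that the denominators
     in [f] do not vanish and that (c + 1)(d + 1) = z and c (d + 1) = y. *)
  have key : (z - y) * (z * y - m ^+ 3) = z * y.
    have -> : (z - y) * (z * y - m ^+ 3) =
        z * y * (z + m ^+ 3 / z - 1 - (y + m ^+ 3 / y) + 1).
      by field; rewrite z0 y0.
    by rewrite E subrr add0r mulr1.
  have zy0 : z - y != 0.
    by apply: contraTneq (mulf_neq0 z0 y0) => zy; rewrite -key zy mul0r eqxx.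
  have zm0 : z * y - m ^+ 3 != 0.
    by apply: contraTneq (mulf_neq0 z0 y0) => zy; rewrite -key zy mulr0 eqxx.
  have cE : y / (z - y) + 1 = z / (z - y) by field.
  have dE : m ^+ 3 / (z * y - m ^+ 3) + 1 = z * y / (z * y - m ^+ 3) by field.
  have zE : z / (z - y) * (z * y / (z * y - m ^+ 3)) = z.
    transitivity (z * (z * y / ((z - y) * (z * y - m ^+ 3)))).
      by field; rewrite zy0 zm0.
    by rewrite key divff ?mulr1 // mulf_neq0.
  have yE : y / (z - y) * (z * y / (z * y - m ^+ 3)) = y.
    transitivity (y * (z * y / ((z - y) * (z * y - m ^+ 3)))).
      by field; rewrite zy0 zm0.
    by rewrite key divff ?mulr1 // mulf_neq0.
  have m30 : m ^+ 3 != 0 by rewrite expf_neq0.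
  rewrite /f /g /= cE dE zE yE; split=> //.
  rewrite /unit2 cE dE !mulf_neq0 ?invr_eq0 ?mulf_neq0 //=.
  rewrite -!LM ?mulf_neq0 ?invr_eq0 ?mulf_neq0 // zE yE Lz Ly !andbT.
  apply/eqP; have -> : y / (z - y) * (z / (z - y)) *
     (m ^+ 3 / (z * y - m ^+ 3) * (z * y / (z * y - m ^+ 3))) =
     m ^+ 3 * ((z * y) ^+ 2 / ((z - y) * (z * y - m ^+ 3)) ^+ 2).
    by field; rewrite zy0 zm0.
  by rewrite key divff ?mulr1 // expf_neq0 // mulf_neq0.
move=> /and5P[/andP[c0 c1] /andP[d0 d1] /eqP mE L1 L2].
have m0 : m != 0.
  apply: contraTneq (mulf_neq0 (mulf_neq0 c0 c1) (mulf_neq0 d0 d1)) => m0.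
  by rewrite -mE m0 expr0n eqxx.
split.
  rewrite m0 /noncube !mulf_neq0 //= !LM // L1 L2 /= mE; apply/eqP.
  by field; rewrite c0 c1 d1.
rewrite /f /g /= mE; congr (_, _, _).
  have -> : (c + 1) * (d + 1) - c * (d + 1) = d + 1 by ring.
  by rewrite mulfK.
have -> : (c + 1) * (d + 1) * (c * (d + 1)) - c * (c + 1) * (d * (d + 1)) =
  c * (c + 1) * (d + 1) by ring.
by field; rewrite c0 c1 d1.
Qed.

(** For given c and d there are three values of m if c (c + 1) d (d + 1) is a cube, and none
    otherwise. What remains depends only on four logarithms and is a sum of products of two
    cyclotomic numbers. *)
Lemma sum_resolvent_pairs :
  (\sum_(p : F * F * F) [&& unit2 p.1.2, unit2 p.2,
     p.1.1 ^+ 3 == p.1.2 * (p.1.2 + 1) * (p.2 * (p.2 + 1)),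
     L (p.1.2 + 1) + L (p.2 + 1) != 0 & L p.1.2 + L (p.2 + 1) != 0]%R =
   12 * (A%R * D%R + 2 * (B%R * C%R)))%N.
Proof.
pose cond i j k l : nat := [&& i + j + (k + l) == 0, j + l != 0 & i + l != 0].
transitivity (3 * \sum_i \sum_j cyclo i j * \sum_k \sum_l cyclo k l * cond i j k l)%N.
  rewrite -(sum_cyclo (fun i j => \sum_k \sum_l cyclo k l * cond i j k l)%N).
  rewrite big_distrr.
  rewrite -(pair_bigA _ (fun p1 p2 => nat_of_bool [&& unit2 p1.2, unit2 p2,
     p1.1 ^+ 3 == p1.2 * (p1.2 + 1) * (p2 * (p2 + 1)),
     L (p1.2 + 1) + L (p2 + 1) != 0 & L p1.2 + L (p2 + 1) != 0]%R)) /=.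
  rewrite -(pair_bigA _ (fun m c => \sum_d nat_of_bool [&& unit2 c, unit2 d,
     m ^+ 3 == c * (c + 1) * (d * (d + 1)),
     L (c + 1) + L (d + 1) != 0 & L c + L (d + 1) != 0]%R)%N) /=.
  rewrite exchange_big; apply: eq_bigr => c _ /=.
  rewrite -(sum_cyclo (fun k l => cond (L c) (L (c + 1)) k l)).
  rewrite exchange_big mulnCA !big_distrr; apply: eq_bigr => d _ /=.
  case: (boolP (unit2 c)) => [/andP[c0 c1]|_] /=; last by rewrite big1.
  case: (boolP (unit2 d)) => [/andP[d0 d1]|_] /=; last by rewrite big1 ?muln0.
  rewrite !mul1n /cond -!LM ?mulf_neq0 //.
  under eq_bigr => m _ do rewrite -mulnb.
  rewrite -big_distrl /= sum_cube_roots ?mulf_neq0 //.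
  by rewrite -mulnA mulnb.
have [e1 e2 e3 e4 e5] := cyclo_values.
rewrite !sumZ3 e1 e2 e3 e4 e5 /cond; decide_bools; nia.
Qed.

Lemma twin_depressed_nonzero :
  (\sum_(m | m != 0%R) \sum_n (depressed m n && depressed m (n - 1)%R) =
   3 * (A%R * D%R + 2 * (B%R * C%R)))%N.
Proof.
(* For m != 0 each of the two cubics has two noncube resolvent roots, so every twin pair is counted
   four times; adding 1 to the cubic replaces n by n - 1. *)
apply/eqP; rewrite -(eqn_pmul2l (isT : 0 < 4)%N) mulnA -[(4 * 3)%N]/12%N.
rewrite -sum_resolvent_pairs -resolvent_pairs big_distrr /=.
rewrite -(pair_bigA _ (fun p1 y => nat_of_bool [&& p1.1 != 0%R, noncube p1.2, noncube y &
     p1.2 + p1.1 ^+ 3 / p1.2 - 1 == y + p1.1 ^+ 3 / y]%R)) /=.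
rewrite -(pair_bigA _ (fun m z => \sum_y nat_of_bool [&& m != 0%R, noncube z, noncube y &
     z + m ^+ 3 / z - 1 == y + m ^+ 3 / y]%R)%N) /=.
apply/eqP; rewrite big_mkcond; apply: eq_bigr => m _ /=.
case: (boolP (m == 0)) => /= [_|m0]; first by rewrite big1 // => z _; rewrite big1.
transitivity (\sum_n nresolvent m n * nresolvent m (n - 1)%R)%N.
  rewrite big_distrr; apply: eq_bigr => n _ /=; rewrite !depressedE.
  move: (nresolvent_pair n m0) (nresolvent_pair (n - 1) m0).
  by case: (0 < nresolvent m n)%N => ->; case: (0 < nresolvent m (n - 1)%R)%N => ->.
under eq_bigr => n _ do rewrite {1}/nresolvent big_distrl /=.
rewrite exchange_big; apply: eq_bigr => z _ /=; rewrite /resolvent.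
case: (noncube z) => /=; last by rewrite !big1.
rewrite (@sum_pred1_mul _ _ (z + m ^+ 3 / z)) => [|n /=]; last by rewrite eq_sym.
by apply: eq_bigr => y _; rewrite /resolvent [_ + _ / y == _]eq_sym.
Qed.

(** T^3 - n has no root exactly when n is a noncube, so this counts pairs of consecutive
    noncubes. *)
Lemma twin_depressed_zero :
  (\sum_n (depressed 0%R n && depressed 0%R (n - 1)%R) = B%R + C%R + 2 * D%R)%N.
Proof.
rewrite (reindex_inj (addIr 1)) /=.
transitivity (\sum_i \sum_j cyclo i j * ((i != 0) && (j != 0))%R)%N.
  rewrite -(sum_cyclo (fun i j => (i != 0) && (j != 0))); apply: eq_bigr => c _.
  rewrite addrK !depressedE !nresolvent0 !lt0b /noncube /unit2 mulnb.
  by case: (c != 0); case: (c + 1 != 0); rewrite //= ?andbF // andbC.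
have [e1 e2 e3 e4 e5] := cyclo_values.
by rewrite !sumZ3 e1 e2 e3 e4 e5; decide_bools; lia.
Qed.

Lemma pi3_01_cyclo :
  (pi3_01 F = q * (3 * (A%R * D%R + 2 * (B%R * C%R)) + (B%R + C%R + 2 * D%R)))%N.
Proof.
have tw h m n : twins (- (3 * h)) (3 * h ^+ 2 - 3 * m) (- h ^+ 3 + 3 * m * h - n) =
    depressed m n && depressed m (n - 1).
  rewrite /twins rootless_depressed.
  have -> : - h ^+ 3 + 3 * m * h - n + 1 = - h ^+ 3 + 3 * m * h - (n - 1) by ring.
  by rewrite rootless_depressed.
rewrite pi3_01_sum3 sum3_depressed -sum_nat_const; apply: eq_bigr => h _.
rewrite (bigD1 0) //= addnC -twin_depressed_zero -twin_depressed_nonzero; congr addn.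
  by apply: eq_bigr => m _; apply: eq_bigr => n _; rewrite tw.
by apply: eq_bigr => n _; rewrite tw.
Qed.

(** With y = c + 1 the equation is x^3 = c (c + 1). The values c = 0 and c = -1 give one point each,
    and any other c gives three points if c (c + 1) is a cube. The total 2 + 3 (A + 2 D) is 9 D - 1
    because D = A + 1. *)
Lemma affine_E_cyclo : (affine_E F).+1 = (9 * D)%N.
Proof.
have [r1 r2] := cyclo_relations.
have [j0 _ _] := jclassE.
suff: (affine_E F = 2 + 3 * jclass 0%R)%N by rewrite j0; lia.
rewrite /affine_E exchange_big /= (reindex_inj (addIr 1)) /=.
rewrite (bigD1 0) //= [X in (_ + X)%N](bigD1 (- 1)) ?oppr_eq0 ?oner_eq0 //=.
have cub0 : (\sum_(x : F) (x ^+ 3 == 0)%R = 1)%N.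
  by apply: (@sum_pred1_nat _ _ 0) => x /=; rewrite expf_eq0.
have z1 : (0 + 1) * (0 + 1 - 1) = 0 :> F by ring.
have z2 : (- 1 + 1) * (- 1 + 1 - 1) = 0 :> F by ring.
rewrite z1 z2 cub0 addnA; congr addn.
rewrite big_mkcond /= big_distrr /=; apply: eq_bigr => c _.
rewrite /unit2 addr_eq0; have [->//|c0] := eqVneq c 0.
have [->//|c1] := eqVneq c (- 1).
have c1' : c + 1 != 0 by rewrite addr_eq0.
by rewrite addrK sum_cube_roots ?mulf_neq0 //= LM // addrC.
Qed.

End CubicLog.

(** * Closed formulas and the bound on the trace *)

Lemma pi3_01_cube_inj (F : finFieldType) : (#|F| %% 3 != 1)%N ->
  (9 * pi3_01 F + #|F| ^ 2 + (if (3 %| #|F|)%N then 3 else 2) * #|F| = #|F| ^ 3)%N.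
Proof.
move=> q1; have := card_twins_moments F; rewrite -pi3_01_sum3.
rewrite sum3_nsplits_nsplits count_quadric; last exact: cube_inj.
have -> : sum3 (fun a b c : F => ncubes a b c * ncubes a b (c + 1)%R)%N =
    ((3 %| #|F|) * #|F|)%N.
  case: (boolP (3 %| #|F|)%N) => d3; rewrite ?mul1n ?mul0n.
    exact/sum3_ncubes_ncubes_char3/three_eq0.
  exact/sum3_ncubes_ncubes0/three_neq0.
have : (1 < #|F|)%N := finNzRing_gt1 F.
(* Writing q = k + 2 removes the truncated subtractions before passing to integers. *)
move: (pi3_01 F) (3 %| #|F|)%N => p b; case: #|F| => [|[|k]] // _.
rewrite !subSS subn0 /= !expnS expn0 !muln1.
rewrite -[k.+2]addn2 -[k.+1]addn1 => H; apply/eqP; rewrite -(eqr_nat int); apply/eqP.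
have := congr1 (fun n => n%:R : int) H; rewrite !(natrD, natrM) => {}H.
set t := b%:R * (k%:R + 2) : int in H.
have E : 9 * p%:R = (k%:R + 2) ^+ 3 - (k%:R + 2) ^+ 2 - 2 * (k%:R + 2) - t :> int.
  set X := 6 * _ in H; set Y := 18 * _ in H.
  have -> : 9 * p%:R = 9 * p%:R + t + X + Y - t - X - Y by ring.
  by rewrite H /X /Y; ring.
by rewrite E /t; case: b {H E t} => /=; ring.
Qed.

(** Each y has exactly one x with x^3 = y (y - 1), and the point at infinity adds one. *)
Lemma card_E_points_cube_inj (F : finFieldType) : (#|F| %% 3 != 1)%N ->
  #|E_points F| = #|F|.+1.
Proof.
move=> q1; rewrite card_E_points /affine_E exchange_big /= -[in RHS]sum1_card.
congr _.+1; apply: eq_bigr => y _.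
have [cbrt cbrtK Kcbrt] := injF_bij (cube_inj q1).
apply: (@sum_pred1_nat _ _ (cbrt (y * (y - 1)))) => x /=.
by rewrite -[RHS](inj_eq (cube_inj q1)) Kcbrt.
Qed.

Lemma cyclotomic_summary (F : finFieldType) : (#|F| %% 3 = 1)%N ->
  exists A B C D : nat,
  [/\ A.+1 = D, #|F| = (3 * (B + C + D) + 1)%N, #|E_points F| = (9 * D)%N,
      pi3_01 F = (#|F| * (3 * (A * D + 2 * (B * C)) + (B + C + 2 * D)))%N
    & ((A + 2 * D) ^ 2 + (3 * C) ^ 2 + (3 * B) ^ 2 =
       #|F| + ((A + 2 * D) * (3 * C) + (3 * C) * (3 * B) + (3 * B) * (A + 2 * D)))%N].
Proof.
move=> q1; have [L [LM L_cube L_surj]] := cubic_log_exists q1.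
have [r1 r2] := cyclo_relations q1 LM L_cube L_surj.
have [j0 j1 j2] := jclassE q1 LM L_cube.
exists (cyclo L 0 0), (cyclo L 1 1), (cyclo L 2 2), (cyclo L 1 2); split.
- by lia.
- by have : (1 < #|F|)%N := finNzRing_gt1 F; lia.
- by rewrite card_E_points (affine_E_cyclo q1 LM L_cube L_surj).
- exact: (pi3_01_cyclo q1 LM L_cube L_surj).
- by rewrite -j0 -j1 -j2; apply: jacobi_norm.
Qed.

Theorem theorem1p2 (R : realType) (q : nat) (F : finFieldType)
    (hq : #|F| = q) :
  let Q : R := q%:R in
  let c : R := cq R F in
  [/\ (q = 0 %[mod 3])%N ->
        (pi3_01 F)%:R = 1 / 9 * Q ^+ 3 * (1 - Q^-1 - 3 * Q ^- 2),
      (q = 1 %[mod 3])%N ->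
        (pi3_01 F)%:R = 1 / 9 * Q ^+ 3 * (1 + (c ^+ 2 - 3) * Q^-1 - 2 * Q ^- 2),
      (q = 2 %[mod 3])%N ->
        (pi3_01 F)%:R = 1 / 9 * Q ^+ 3 * (1 - Q^-1 - 2 * Q ^- 2)
    & ~~ (3 %| q)%N -> 0 <= c ^+ 2 <= 4].
Proof.
move=> Q c.
have q_gt1 : (1 < q)%N by rewrite -hq; exact: finNzRing_gt1.
have Q_gt0 : 0 < Q by rewrite ltr0n; lia.
have Q0 : Q != 0 by rewrite gt_eqF.
have n9 : 9 != 0 :> R by rewrite pnatr_eq0.
have c2 : c ^+ 2 = (1 + Q - #|E_points F|%:R) ^+ 2 / Q.
  by rewrite /c /cq hq expr_div_n sqr_sqrtr // ltW.
have case1 : (q %% 3 = 1)%N ->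
  (9 * (pi3_01 F)%:R = Q * (Q ^+ 2 + (1 + Q - #|E_points F|%:R) ^+ 2 - 3 * Q - 2)
   /\ (1 + Q - #|E_points F|%:R) ^+ 2 <= 4 * Q).
  rewrite -hq => /cyclotomic_summary[A [B [C [D [AD qE EE piE normE]]]]].
  have {}normE := congr1 (fun n => n%:R : R) normE.
  have QE : Q = 3 * (B%:R + C%:R + D%:R) + 1 by rewrite /Q -hq qE !(natrD, natrM).
  have AE : A%:R = D%:R - 1 :> R by rewrite -AD -natr1 addrK.
  rewrite EE piE hq !(natrD, natrM, natrX) AE -/Q in normE *.
  move: normE; rewrite QE; move: (B%:R) (C%:R) (D%:R) => b c' d {}normE.
  move/eqP: normE; rewrite -subr_eq0; set nE := (X in X == 0) => /eqP n0.
  split.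
    (* The two sides differ by a multiple of the norm relation [n0], with factor 2 q. *)
    rewrite -[LHS]addr0 -[0](mulr0 (2 * (3 * (b + c' + d) + 1))) -n0 /nE; ring.
  rewrite -subr_ge0.
  (* Modulo the norm relation this is the classical representation 4 q = (q + 1 - 9 D)^2 + 27 (B -
     C)^2. *)
  have -> : 4 * (3 * (b + c' + d) + 1) - (1 + (3 * (b + c' + d) + 1) - 9 * d) ^+ 2 =
     27 * (b - c') ^+ 2 - 4 * nE by rewrite /nE; ring.
  by rewrite n0 mulr0 subr0 mulr_ge0 // sqr_ge0.
split.
- rewrite mod0n => q3; have := @pi3_01_cube_inj F; rewrite hq q3 /dvdn q3 => /(_ isT).
  move/(congr1 (fun n => n%:R : R)); rewrite !(natrD, natrM, natrX) -/Q => E.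
  have piE : 9 * (pi3_01 F)%:R = Q ^+ 3 - Q ^+ 2 - 3 * Q by rewrite -E; ring.
  by apply: (mulfI n9); rewrite piE; field.
- rewrite [(1 %% 3)%N]modn_small // => /case1[piE _].
  by apply: (mulfI n9); rewrite piE c2; field.
- rewrite [(2 %% 3)%N]modn_small // => q3; have := @pi3_01_cube_inj F.
  rewrite hq q3 /dvdn q3 => /(_ isT).
  move/(congr1 (fun n => n%:R : R)); rewrite !(natrD, natrM, natrX) -/Q => E.
  have piE : 9 * (pi3_01 F)%:R = Q ^+ 3 - Q ^+ 2 - 2 * Q by rewrite -E; ring.
  by apply: (mulfI n9); rewrite piE; field.
- move=> n3; rewrite sqr_ge0 /= c2 ler_pdivrMr //.
  have : (q %% 3 < 3)%N by rewrite ltn_mod.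
  case E: (q %% 3)%N => [|[|[|]]] // _; first by rewrite /dvdn E in n3.
    by case: (case1 E).
  (* For q = 2 mod 3 the trace 1 + q - #E is 0. *)
  rewrite card_E_points_cube_inj ?hq ?E // -natr1 -/Q [1 + Q]addrC subrr expr0n /=.
  by rewrite mulr_ge0 // ltW.
Qed.
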